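(* (Projection formula) Let $f:(X_1,P_1)\to (X_2,P_2)$ be an étale cover of formal orbifolds with $(X_2,P_2)$ geometric. Let $\mathcal V$ be a vector bundle on the geometric formal orbifold $(X_2,P_2)$ and let $\mathcal F$ be a vector bundle on the geometric formal orbifold $(X_1,P_1)$. Then there is an isomorphism of vector bundles on $(X_2,P_2)$ $$\hat{f}_*(\hat{f}^*\mathcal V\,\hat\otimes\, \mathcal{F}) \cong \mathcal V\,\hat\otimes\, \hat{f}_*(\mathcal{F}).$$
   Context: Let $k$ be an algebraically closed field of arbitrary characteristic; all curves are over $k$. A covering of smooth projective curves is a finite generically étale (separable) morphism. For a smooth projective curve $X$ and a closed point $x\in X$, $\mathcal{K}_{X,x}$ denotes the fraction field of $\widehat{\mathcal O}_{X,x}$. A branch data on $X$ is a function $P$ assigning to each closed point $x\in X$ a finite Galois extension $P(x)$ of $\mathcal K_{X,x}$ such that $\{x: P(x)\ne \mathcal K_{X,x}\}$ is finite; $O$ denotes the trivial branch data. A formal orbifold is a pair $(X,P)$ with $X$ a smooth projective curve and $P$ a branch data on $X$. A morphism of formal orbifolds $f:(Y,Q)\to(X,P)$ is a covering $f:Y\to X$ such that for every closed point $y\in Y$ the extension $Q(y)/\mathcal K_{X,f(y)}$ contains $P(f(y))/\mathcal K_{X,f(y)}$; it is étale if $Q(y)=P(f(y))$ for all $y$. $(X,P)$ is geometric if there is a connected étale cover $(Y,O)\to(X,P)$. For a finite group $\Gamma$ acting on $Y$, with action map $\mu:\Gamma\times Y\to Y$ and second projection $p$, a $\Gamma$-bundle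 on $Y$ is a vector bundle $V$ with an isomorphism $\lambda:\mu^*V\to p^*V$ such that $\lambda_g=\lambda|_{g\times Y}:g^*V\to V$ satisfy $\lambda_{gh}=\lambda_h\circ h^*\lambda_g$; morphisms are $\Gamma$-equivariant homomorphisms. A vector bundle on a geometric formal orbifold $(X,P)$ is a $\Gamma$-bundle on $Y$, where $(Y,O)\to(X,P)$ is an étale Galois cover with group $\Gamma$; the category does not depend on the chosen cover. The tensor product $\hat\otimes$ of two vector bundles on $(X,P)$ is the usual tensor product of $\Gamma$-bundles on an étale Galois cover on which both are represented. Direct and inverse image: let $f:(X_1,P_1)\to (X_2,P_2)$ be an étale cover and let $(Y_2,O)\to(X_2,P_2)$ be an étale Galois cover with group $\Gamma$. Let $Y_1$ be the normalization of $X_1\times_{X_2}Y_2$ (possibly disconnected). Then $\tilde f: Y_1\to Y_2$ is étale, and $(Y_1,O)\to(X_1,P_1)$ is an étale Galois cover with group $\Gamma$; every vector bundle on $(X_1,P_1)$ is represented by a $\Gamma$-bundle on $Y_1$. For $\mathcal F$ on $(X_1,P_1)$ represented by a $\Gamma$-bundle $F$ on $Y_1$, $\hat f_*\mathcal F$ is the vector bundle on $(X_2,P_2)$ represented by the $\Gamma$-bundle $\tilde f_*F$ on $Y_2$. For $\mathcal V$ on $(X_2,P_2)$ represented by a $\Gamma$-bundle $V$ on $Y_2$, $\hat f^*\mathcal V$ is the vector bundle on $(X_1,P_1)$ represented by the $\Gamma$-bundle $\tilde f^*V$ on $Y_1$. *)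

(* Defs.v *)
From HB Require Import structures.
From mathcomp Require Import all_boot all_algebra all_fingroup all_field.
From mathcomp Require Import boolp classical_sets cardinality topology.
From mathcomp Require Import ring.
From mathcomp Require fraction mpoly.

Set Implicit Arguments.
Unset Strict Implicit.
Unset Printing Implicit Defensive.

Import GRing.Theory.
Local Open Scope classical_set_scope.
Local Open Scope ring_scope.

Definition eclass (T : Type) (e : T -> T -> Prop) : Type :=
  {C : set T | exists t, C = e t}.

Section EClass.
Variables (T : Type) (e : T -> T -> Prop).
Hypotheses (e_refl : forall x, e x x) (e_sym : forall x y, e x y -> e y x)
  (e_trans : forall y x z, e x y -> e y z -> e x z).

Definition ecl (t : T) : eclass e := exist _ (e t) (ex_intro _ t erefl).
Definition erepr (c : eclass e) : T := projT1 (cid (proj2_sig c)).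

Lemma ereprK (c : eclass e) : ecl (erepr c) = c.
Proof.
by case: c => C hC; apply: eq_exist => /=; rewrite /erepr; case: (cid _).
Qed.

Lemma eclP (s t : T) : (ecl s = ecl t) <-> e s t.
Proof.
split=> [[h]|h].
  by rewrite (_ : e s t = e t t) ?h.
apply: eq_exist; apply/funext => x; apply/propext; split => h'.
  exact: e_trans (e_sym h) h'.
exact: e_trans h h'.
Qed.

Lemma erepr_cl t : e (erepr (ecl t)) t.
Proof. by apply/eclP; rewrite ereprK. Qed.
End EClass.

Record ring_pres := RingPres {
  rp_sort : Type;
  rp_eqv : rp_sort -> rp_sort -> Prop;
  rp_zero : rp_sort;
  rp_one : rp_sort;
  rp_opp : rp_sort -> rp_sort;
  rp_add : rp_sort -> rp_sort -> rp_sort;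
  rp_mul : rp_sort -> rp_sort -> rp_sort;
  rp_refl : forall x, rp_eqv x x;
  rp_sym : forall x y, rp_eqv x y -> rp_eqv y x;
  rp_trans : forall y x z, rp_eqv x y -> rp_eqv y z -> rp_eqv x z;
  rp_oppE : forall x y, rp_eqv x y -> rp_eqv (rp_opp x) (rp_opp y);
  rp_addE : forall x x' y y', rp_eqv x x' -> rp_eqv y y' ->
    rp_eqv (rp_add x y) (rp_add x' y');
  rp_mulE : forall x x' y y', rp_eqv x x' -> rp_eqv y y' ->
    rp_eqv (rp_mul x y) (rp_mul x' y');
  rp_addA : forall x y z,
    rp_eqv (rp_add x (rp_add y z)) (rp_add (rp_add x y) z);
  rp_addC : forall x y, rp_eqv (rp_add x y) (rp_add y x);
  rp_add0 : forall x, rp_eqv (rp_add rp_zero x) x;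
  rp_addN : forall x, rp_eqv (rp_add (rp_opp x) x) rp_zero;
  rp_mulA : forall x y z,
    rp_eqv (rp_mul x (rp_mul y z)) (rp_mul (rp_mul x y) z);
  rp_mulC : forall x y, rp_eqv (rp_mul x y) (rp_mul y x);
  rp_mul1 : forall x, rp_eqv (rp_mul rp_one x) x;
  rp_mulD : forall x y z,
    rp_eqv (rp_mul (rp_add x y) z) (rp_add (rp_mul x z) (rp_mul y z));
  rp_nz : ~ rp_eqv rp_one rp_zero }.

Definition quot_ring (S : ring_pres) : Type := eclass (@rp_eqv S).

Section QuotRing.
Variable S : ring_pres.
Local Notation Q := (quot_ring S).
Definition qcl (x : rp_sort S) : Q := ecl (@rp_eqv S) x.
Definition qrepr (c : Q) : rp_sort S := erepr c.

Lemma qreprK c : qcl (qrepr c) = c. Proof. exact: ereprK. Qed.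
Lemma qclP x y : qcl x = qcl y <-> rp_eqv x y.
Proof. by apply: eclP; [exact: rp_refl|exact: rp_sym|exact: rp_trans]. Qed.
Lemma qrepr_cl x : rp_eqv (qrepr (qcl x)) x.
Proof. by apply/qclP; rewrite qreprK. Qed.

Let add (c d : Q) := qcl (rp_add (qrepr c) (qrepr d)).
Let mul (c d : Q) := qcl (rp_mul (qrepr c) (qrepr d)).
Let opp (c : Q) := qcl (rp_opp (qrepr c)).

Let addE x y : add (qcl x) (qcl y) = qcl (rp_add x y).
Proof. by apply/qclP/rp_addE; exact: qrepr_cl. Qed.
Let mulE x y : mul (qcl x) (qcl y) = qcl (rp_mul x y).
Proof. by apply/qclP/rp_mulE; exact: qrepr_cl. Qed.
Let oppE x : opp (qcl x) = qcl (rp_opp x).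
Proof. by apply/qclP/rp_oppE; exact: qrepr_cl. Qed.

Let addA : associative add.
Proof.
move=> x y z; rewrite -(qreprK x) -(qreprK y) -(qreprK z) !addE.
exact/qclP/rp_addA.
Qed.
Let addC : commutative add.
Proof. by move=> x y; exact/qclP/rp_addC. Qed.
Let add0 : left_id (qcl (rp_zero S)) add.
Proof. by move=> x; rewrite -(qreprK x) addE; exact/qclP/rp_add0. Qed.
Let addN : left_inverse (qcl (rp_zero S)) opp add.
Proof. by move=> x; rewrite -(qreprK x) oppE addE; exact/qclP/rp_addN. Qed.
Let mulA : associative mul.
Proof.
move=> x y z; rewrite -(qreprK x) -(qreprK y) -(qreprK z) !mulE.
exact/qclP/rp_mulA.
Qed.
Let mulC : commutative mul.
Proof. by move=> x y; exact/qclP/rp_mulC. Qed.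
Let mul1 : left_id (qcl (rp_one S)) mul.
Proof. by move=> x; rewrite -(qreprK x) mulE; exact/qclP/rp_mul1. Qed.
Let mulD : left_distributive mul add.
Proof.
move=> x y z; rewrite -(qreprK x) -(qreprK y) -(qreprK z) !(addE, mulE).
exact/qclP/rp_mulD.
Qed.

HB.instance Definition _ := gen_eqMixin Q.
HB.instance Definition _ := gen_choiceMixin Q.
HB.instance Definition _ := GRing.isZmodule.Build Q addA addC add0 addN.
Let nz' : qcl (rp_one S) != 0 :> Q.
Proof. by apply/eqP => /qclP; exact: rp_nz. Qed.
HB.instance Definition _ :=
  GRing.Zmodule_isComNzRing.Build Q mulA mulC mul1 mulD nz'.

Lemma qclD x y : qcl (rp_add x y) = qcl x + qcl y. Proof. by rewrite -addE. Qed.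
Lemma qclM x y : qcl (rp_mul x y) = qcl x * qcl y. Proof. by rewrite -mulE. Qed.
Lemma qcl0 : qcl (rp_zero S) = 0. Proof. by []. Qed.
Lemma qcl1 : qcl (rp_one S) = 1. Proof. by []. Qed.
End QuotRing.

Section DVR.
Variable R : comNzRingType.

Definition is_unit (a : R) : Prop := exists b, a * b = 1.

Definition is_uniformizer (p : R) : Prop :=
  [/\ ~ is_unit p, forall n, p ^+ n != 0 &
      forall a : R, a != 0 -> exists n u, is_unit u /\ a = u * p ^+ n].

Definition is_dvr : Prop := exists p, is_uniformizer p.

(* The n-th power of the set of non-units, which is the maximal ideal when R is
   local. *)
Fixpoint max_pow (n : nat) : set R :=
  if n is n'.+1 then
    [set a | exists s : seq (R * R), (forall x, x \in s ->
        ~ is_unit x.1 /\ max_pow n' x.2) /\ a = \sum_(x <- s) x.1 * x.2]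
  else setT.

Lemma max_powP p n a : is_uniformizer p ->
  max_pow n a <-> exists b, a = p ^+ n * b.
Proof.
move=> [pu pn0 fac]; elim: n a => [|n IH] a /=.
  by split=> // _; exists a; rewrite expr0 mul1r.
split.
  move=> [s [hs ->]] {a}; elim: s hs => [|x s IHs] hs.
    by exists 0; rewrite big_nil mulr0.
  case: IHs => [y ys|b hb]; first by apply: hs; rewrite inE ys orbT.
  have [x1 /IH [c xc]] := hs x (mem_head _ _).
  have [d xd] : exists d, x.1 = p * d.
    have [->|x10] := eqVneq x.1 0; first by exists 0; rewrite mulr0.
    have [[|i] [u [uu xu]]] := fac _ x10.
      by case: x1; rewrite xu expr0 mulr1.
    by exists (u * p ^+ i); rewrite xu exprS mulrCA.
  exists (d * c + b); rewrite big_cons hb xd xc exprS mulrDr; congr (_ + _).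
  by rewrite !mulrA; congr (_ * _); rewrite -!mulrA; congr (_ * _); exact: mulrC.
move=> [b ->]; exists [:: (p, p ^+ n * b)]; split; last first.
  by rewrite big_seq1 /= exprS mulrA.
move=> x; rewrite inE => /eqP -> /=; split => //.
by apply/IH; exists b.
Qed.

Lemma max_pow_closed n : is_dvr -> [/\ max_pow n 0,
  (forall a b, max_pow n a -> max_pow n b -> max_pow n (a + b)) &
  (forall a b, max_pow n b -> max_pow n (a * b))].
Proof.
move=> [p hp]; split.
- by apply/(max_powP _ _ hp); exists 0; rewrite mulr0.
- move=> a b /(max_powP _ _ hp) [c ->] /(max_powP _ _ hp) [d ->].
  by apply/(max_powP _ _ hp); exists (c + d); rewrite mulrDr.
- move=> a b /(max_powP _ _ hp) [c ->].
  by apply/(max_powP _ _ hp); exists (a * c); rewrite mulrCA.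
Qed.

Hypothesis Rdvr : is_dvr.

Lemma max_powS n a : max_pow n.+1 a -> max_pow n a.
Proof.
have [p hp] := Rdvr; move=> /(max_powP _ _ hp) [b ->].
by apply/(max_powP _ _ hp); exists (p * b); rewrite exprSr mulrA.
Qed.

(* An element of lim_n R/m^n, given by representatives of its components. *)
Definition coherent (s : nat -> R) : Prop :=
  forall n, max_pow n (s n.+1 - s n).
Definition coh : Type := {s : nat -> R | coherent s}.
Definition coh_eqv (s t : coh) : Prop :=
  forall n, max_pow n (proj1_sig s n - proj1_sig t n).

Let mp0 n : max_pow n 0. Proof. by have [] := max_pow_closed n Rdvr. Qed.
Let mpD n a b : max_pow n a -> max_pow n b -> max_pow n (a + b).
Proof. by have [_ h _] := max_pow_closed n Rdvr; exact: h. Qed.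
Let mpM n a b : max_pow n b -> max_pow n (a * b).
Proof. by have [_ _ h] := max_pow_closed n Rdvr; exact: h. Qed.
Let mpN n a : max_pow n a -> max_pow n (- a).
Proof. by rewrite -mulN1r; exact: mpM. Qed.

Let cst_coh (c : R) : coherent (fun=> c).
Proof. by move=> n; rewrite subrr. Qed.
Let opp_coh s : coherent s -> coherent (fun n => - s n).
Proof. by move=> h n; rewrite -opprD; exact: mpN. Qed.
Let add_coh s t : coherent s -> coherent t -> coherent (fun n => s n + t n).
Proof. by move=> h h' n; rewrite opprD addrACA; exact: mpD. Qed.
Let subM (a b c d : R) : a * c - b * d = a * (c - d) + d * (a - b).
Proof. by rewrite !mulrBr addrA (mulrC d a) subrK (mulrC d b). Qed.
Let mul_coh s t : coherent s -> coherent t -> coherent (fun n => s n * t n).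
Proof. by move=> h h' n; rewrite subM; apply: mpD; exact: mpM. Qed.

Let C0 : coh := exist _ _ (cst_coh 0).
Let C1 : coh := exist _ _ (cst_coh 1).
Let Copp (s : coh) : coh := exist _ _ (opp_coh (proj2_sig s)).
Let Cadd (s t : coh) : coh := exist _ _ (add_coh (proj2_sig s) (proj2_sig t)).
Let Cmul (s t : coh) : coh := exist _ _ (mul_coh (proj2_sig s) (proj2_sig t)).

Let sub0 n (a b : R) : a = b -> max_pow n (a - b).
Proof. by move=> ->; rewrite subrr. Qed.

Definition completion_pres : ring_pres.
Proof.
refine (@RingPres coh coh_eqv C0 C1 Copp Cadd Cmul
  _ _ _ _ _ _ _ _ _ _ _ _ _ _ _) => /=.
- by move=> x n; exact: sub0.
- by move=> x y h n; rewrite -opprB; exact: mpN.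
- by move=> y x z h h' n; rewrite -(subrKA (proj1_sig y n)); exact: mpD.
- by move=> x y h n /=; rewrite -opprD; exact: mpN.
- by move=> x x' y y' h h' n /=; rewrite opprD addrACA; exact: mpD.
- by move=> x x' y y' h h' n /=; rewrite subM; apply: mpD; exact: mpM.
- by move=> x y z n; apply: sub0; rewrite /= addrA.
- by move=> x y n; apply: sub0; rewrite /= addrC.
- by move=> x n; apply: sub0; rewrite /= add0r.
- by move=> x n; apply: sub0; rewrite /= addNr.
- by move=> x y z n; apply: sub0; rewrite /= mulrA.
- by move=> x y n; apply: sub0; rewrite /= mulrC.
- by move=> x n; apply: sub0; rewrite /= mul1r.
- by move=> x y z n; apply: sub0; rewrite /= mulrDl.
- have [p hp] := Rdvr; move=> /(_ 1) /(max_powP _ _ hp) [b] /=.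
  rewrite subr0 expr1 => h; have [pu _ _] := hp.
  by apply: pu; exists b.
Defined.

Definition completion : Type := quot_ring completion_pres.
HB.instance Definition _ := GRing.ComNzRing.on completion.

Definition completion_cl (s : nat -> R) : completion :=
  if pselect (coherent s) is left h then @qcl completion_pres (exist _ s h)
  else 0.
Definition completion_repr (a : completion) : nat -> R := proj1_sig (qrepr a).

Let cunit : pred completion := fun a => `[< exists b, b * a = 1 >].
Let cinv (a : completion) : completion :=
  if pselect (exists b, b * a = 1) is left h then projT1 (cid h) else a.
Let cmulVx : {in cunit, left_inverse 1 cinv *%R}.
Proof.
move=> a /asboolP h; rewrite /cinv.
by case: pselect => // h'; case: (cid h').
Qed.
Let cunitP (a b : completion) : b * a = 1 -> cunit a.
Proof. by move=> h; apply/asboolP; exists b. Qed.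
Let cinv_out : {in [predC cunit], cinv =1 id}.
Proof.
move=> a /asboolPn h; rewrite /cinv; by case: pselect.
Qed.
HB.instance Definition _ :=
  GRing.ComNzRing_hasMulInverse.Build completion cmulVx cunitP cinv_out.

Lemma completion_nz (a : completion) : a != 0 ->
  exists n, ~ max_pow n (completion_repr a n).
Proof.
move=> a0; apply: contrapT => h; move/eqP: a0; apply.
rewrite -(qreprK a) -qcl0; apply/qclP => n /=; rewrite subr0.
by apply: contrapT => h'; apply: h; exists n.
Qed.

Lemma coherent_le (s : nat -> R) n N : coherent s -> (n <= N)%N ->
  max_pow n (s N - s n).
Proof.
move=> hs /subnK <-; elim: (N - n)%N => [|i IH].
  by rewrite add0n; exact: sub0.
rewrite addSn -(subrKA (s (i + n)%N)); apply: mpD IH.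
have := hs (i + n)%N; elim: {1}i => [//|j IHj] h.
by apply: IHj; apply: max_powS; rewrite -addSn.
Qed.

Lemma completion_integral (a b : completion) :
  a * b = 0 -> (a == 0) || (b == 0).
Proof.
move=> ab0; case: eqVneq => //= a0; case: eqVneq => //= b0; exfalso.
have [p hp] := Rdvr; have [pu pn0 fac] := hp.
have [n hn] := completion_nz a0; have [m hm] := completion_nz b0.
set s := completion_repr a in hn; set t := completion_repr b in hm.
have cs : coherent s := proj2_sig (qrepr a).
have ct : coherent t := proj2_sig (qrepr b).
have key (r : nat -> R) i j : coherent r -> (i <= j)%N -> ~ max_pow i (r i) ->
    exists2 l, (l < i)%N & exists2 u, is_unit u & r j = u * p ^+ l.
  move=> cr ij hr.
  have hj : ~ max_pow i (r j).
    move=> h; apply: hr; rewrite -(subKr (r j) (r i)).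
    by apply: mpD => //; apply: mpN; exact: coherent_le.
  have rj0 : r j != 0 by apply/eqP => r0; apply: hj; rewrite r0.
  have [l [u [uu ru]]] := fac _ rj0; exists l; last by exists u.
  rewrite ltnNge; apply/negP => il; apply: hj; rewrite ru.
  apply/(max_powP _ _ hp); exists (u * p ^+ (l - i)).
  by rewrite mulrCA -exprD subnKC.
have [i li [u [u' uu] su]] := key s n (n + m)%N cs (leq_addr _ _) hn.
have [j lj [v [v' vv] tv]] := key t m (n + m)%N ct (leq_addl _ _) hm.
have : max_pow (n + m) (s (n + m)%N * t (n + m)%N).
  have : a * b = 0 by [].
  rewrite -{1}(qreprK a) -{1}(qreprK b) -qclM -qcl0 => /qclP /(_ (n + m)%N) /=.
  by rewrite subr0.
move=> /(max_powP _ _ hp) [c]; rewrite su tv => h.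
have lij : (i + j < n + m)%N by rewrite -addSn leq_add // ltnW.
set d := ((n + m) - (i + j).+1)%N.
have hd : (n + m = (i + j) + d.+1)%N by rewrite addnS -addSn subnKC.
have h0 : p ^+ (i + j) * (u * v - p ^+ d.+1 * c) = 0.
  by rewrite mulrBr [X in _ - X]mulrA -exprD -hd -h exprD; ring.
have [w0|w0] := eqVneq (u * v - p ^+ d.+1 * c) 0.
  apply: pu; exists (p ^+ d * c * (u' * v')).
  rewrite !mulrA -exprS -(subr0_eq w0) -!mulrA (mulrCA v) (mulrA u) uu mul1r.
  by rewrite vv.
have [l [x [[x' xx] wx]]] := fac _ w0.
have : p ^+ (i + j + l) = 0.
  rewrite exprD -[p ^+ l]mul1r -xx (mulrC x) -mulrA -wx mulrCA.
  by rewrite h0 mulr0.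
by move/eqP; rewrite (negPf (pn0 _)).
Qed.

Let comp_int : GRing.integral_domain_axiom completion.
Proof. by move=> a b; exact: completion_integral. Qed.
HB.instance Definition _ :=
  GRing.ComUnitRing_isIntegral.Build completion comp_int.
End DVR.

Section Spaces.
Variable k : closedFieldType.

(* Ringed spaces whose structure sheaf consists of k-valued functions.
   [reg U f] says that f is regular on the open set U; it depends only on the
   restriction of f to U. *)
Record kspace := Space {
  pts :> topologicalType;
  reg : set pts -> (pts -> k) -> Prop;
  reg_cst : forall (U : set pts) (c : k), open U -> reg U (fun=> c);
  reg_add : forall (U : set pts) f g, open U -> reg U f -> reg U g ->
    reg U (fun x => f x + g x);
  reg_mul : forall (U : set pts) f g, open U -> reg U f -> reg U g ->
    reg U (fun x => f x * g x);
  reg_local : forall (U : set pts) f, open U ->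
    (reg U f <-> forall x, U x -> exists (V : set pts) g,
      [/\ open V, V x, reg V g & forall y, V y -> U y -> f y = g y]);
  reg_nz : forall (U : set pts) f, open U -> reg U f ->
    open [set x | U x /\ f x <> 0];
  reg_inv : forall (U : set pts) f, open U -> reg U f ->
    (forall x, U x -> f x <> 0) -> reg U (fun x => (f x)^-1) }.

Lemma reg_sub (X : kspace) (U V : set X) f :
  open U -> open V -> V `<=` U -> reg U f -> reg V f.
Proof.
move=> oU oV VU fU; apply/reg_local => // x Vx; exists U, f.
by split => //; exact: VU.
Qed.

Lemma reg_eq (X : kspace) (U : set X) f g :
  open U -> (forall x, U x -> f x = g x) -> reg U f -> reg U g.
Proof.
move=> oU fg fU; apply/reg_local => // x Ux; exists U, f.
by split => // y Uy _; rewrite fg.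
Qed.

Lemma reg_opp (X : kspace) (U : set X) f :
  open U -> reg U f -> reg U (fun x => - f x).
Proof.
move=> oU fU; apply: (@reg_eq X U (fun x => (-1) * f x)) => //.
  by move=> x _; rewrite mulN1r.
by apply: reg_mul => //; exact: reg_cst.
Qed.

Record smorphism (Y X : kspace) := Morphism {
  mfun :> Y -> X;
  mcont : forall U : set X, open U -> open (mfun @^-1` U);
  mreg : forall (U : set X) f, open U -> reg U f ->
    reg (mfun @^-1` U) (f \o mfun) }.

Definition mcomp (Z Y X : kspace) (f : smorphism Y X) (g : smorphism Z Y) :
  smorphism Z X :=
  @Morphism Z X (f \o g) (fun U oU => mcont g (mcont f oU))
    (fun U h oU hU => mreg g (mcont f oU) (mreg f oU hU)).

Section Germs.
Variables (X : kspace) (x : X).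

Definition reg_at (f : X -> k) : Prop :=
  exists U : set X, [/\ open U, U x & reg U f].
Definition eq_near (f g : X -> k) : Prop :=
  exists U : set X, [/\ open U, U x & forall y, U y -> f y = g y].

Let reg_at2 f g (op : (X -> k) -> (X -> k) -> X -> k) :
  (forall U : set X, open U -> reg U f -> reg U g -> reg U (op f g)) ->
  reg_at f -> reg_at g -> reg_at (op f g).
Proof.
move=> h [U [oU Ux fU]] [V [oV Vx gV]].
have oUV := openI oU oV; exists (U `&` V); split => //.
apply: h => //; first exact: (reg_sub oU oUV (@subIsetl _ _ _)).
exact: (reg_sub oV oUV (@subIsetr _ _ _)).
Qed.

Let eq_near2 f f' g g' (op : k -> k -> k) : eq_near f f' -> eq_near g g' ->
  eq_near (fun y => op (f y) (g y)) (fun y => op (f' y) (g' y)).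
Proof.
move=> [U [oU Ux fU]] [V [oV Vx gV]].
exists (U `&` V); split => //; first exact: openI.
by move=> y [Uy Vy]; rewrite fU ?gV.
Qed.

Let reg_at_cst c : reg_at (fun=> c).
Proof.
by exists setT; split=> //; [exact: openT|apply: reg_cst; exact: openT].
Qed.
Let reg_at_opp f : reg_at f -> reg_at (fun y => - f y).
Proof. by move=> [U [oU Ux fU]]; exists U; split => //; exact: reg_opp. Qed.
Let reg_at_add f g : reg_at f -> reg_at g -> reg_at (fun y => f y + g y).
Proof.
by apply: (reg_at2 (op := fun f g y => f y + g y)) => U; exact: reg_add.
Qed.
Let reg_at_mul f g : reg_at f -> reg_at g -> reg_at (fun y => f y * g y).
Proof.
by apply: (reg_at2 (op := fun f g y => f y * g y)) => U; exact: reg_mul.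
Qed.

Let pg : Type := {f : X -> k | reg_at f}.
Let g0 : pg := exist _ _ (reg_at_cst 0).
Let g1 : pg := exist _ _ (reg_at_cst 1).
Let gopp (f : pg) : pg := exist _ _ (reg_at_opp (proj2_sig f)).
Let gadd (f g : pg) : pg := exist _ _ (reg_at_add (proj2_sig f) (proj2_sig g)).
Let gmul (f g : pg) : pg := exist _ _ (reg_at_mul (proj2_sig f) (proj2_sig g)).
Let eqn (f g : X -> k) : (forall y, f y = g y) -> eq_near f g.
Proof. by move=> fg; exists setT; split => //; exact: openT. Qed.

Definition germ_pres : ring_pres.
Proof.
refine (@RingPres pg (fun f g => eq_near (proj1_sig f) (proj1_sig g))
  g0 g1 gopp gadd gmul _ _ _ _ _ _ _ _ _ _ _ _ _ _ _) => /=.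
- by move=> f; exact: eqn.
- by move=> f g [U [oU Ux h]]; exists U; split => // y /h ->.
- move=> g f h [U [oU Ux fU]] [V [oV Vx gV]].
  exists (U `&` V); split => //; first exact: openI.
  by move=> y [Uy Vy]; rewrite fU ?gV.
- by move=> f g [U [oU Ux h]]; exists U; split => // y /h ->.
- by move=> f f' g g'; exact: (eq_near2 (fun a b => a + b)).
- by move=> f f' g g'; exact: (eq_near2 (fun a b => a * b)).
- by move=> f g h; apply: eqn => y; rewrite addrA.
- by move=> f g; apply: eqn => y; rewrite addrC.
- by move=> f; apply: eqn => y; rewrite add0r.
- by move=> f; apply: eqn => y; rewrite addNr.
- by move=> f g h; apply: eqn => y; rewrite mulrA.
- by move=> f g; apply: eqn => y; rewrite mulrC.
- by move=> f; apply: eqn => y; rewrite mul1r.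
- by move=> f g h; apply: eqn => y; rewrite mulrDl.
- by move=> [U [_ Ux h]]; move/eqP: (h _ Ux); rewrite oner_eq0.
Defined.

Definition local_ring : Type := quot_ring germ_pres.
HB.instance Definition _ := GRing.ComNzRing.on local_ring.

Definition germ (f : X -> k) : local_ring :=
  if pselect (reg_at f) is left h then @qcl germ_pres (exist _ f h) else 0.
Definition germ_repr (a : local_ring) : X -> k := proj1_sig (qrepr a).
End Germs.

Definition germ_pull (Y X : kspace) (f : smorphism Y X) (y : Y)
  (a : local_ring (f y)) : local_ring y := germ y (germ_repr a \o f).

Definition homog n (d : nat) (p : mpoly.mpoly n k) : Prop :=
  forall m : mpoly.multinom n, mpoly.mcoeff m p <> 0 -> mpoly.mdeg m = d.

(* The open subset U is isomorphic, via phi, to the closed subset of affine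
   n-space defined by S. *)
Definition affine_open (X : kspace) (U : set X) : Prop :=
  open U /\ exists n (phi : X -> 'I_n -> k) (S : set (mpoly.mpoly n k)),
  [/\ forall v : 'I_n -> k, (forall p, S p -> mpoly.meval v p = 0) <->
        (exists2 x, U x & phi x = v),
      forall x y, U x -> U y -> phi x = phi y -> x = y,
      forall W : set X, W `<=` U -> (open W <->
        exists T : set (mpoly.mpoly n k),
          W = [set x | U x /\ exists2 p, T p & mpoly.meval (phi x) p <> 0]) &
      forall (W : set X) (f : X -> k), W `<=` U -> open W -> (reg W f <->
        forall x, W x -> exists p q : mpoly.mpoly n k,
          mpoly.meval (phi x) q <> 0 /\
          forall y, W y -> mpoly.meval (phi y) q <> 0 ->
            f y = mpoly.meval (phi y) p / mpoly.meval (phi y) q)].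

(* X is isomorphic to the closed subset of projective n-space defined by S;
   phi x is a choice of homogeneous coordinates of the image of x. *)
Definition is_projective (X : kspace) : Prop :=
  exists n (phi : X -> 'I_n.+1 -> k) (S : set (mpoly.mpoly n.+1 k)),
  [/\ (forall p, S p -> exists d, homog d p) /\
      (forall x, exists i, phi x i <> 0),
      forall v : 'I_n.+1 -> k, (exists i, v i <> 0) ->
        ((forall p, S p -> mpoly.meval v p = 0) <->
         (exists x c, c <> 0 /\ v = (fun i => c * phi x i))),
      forall x y c, phi x = (fun i => c * phi y i) -> x = y,
      forall W : set X, open W <-> exists T : set (mpoly.mpoly n.+1 k),
        (forall p, T p -> exists d, homog d p) /\
        W = [set x | exists2 p, T p & mpoly.meval (phi x) p <> 0] &
      forall (W : set X) (f : X -> k), open W -> (reg W f <->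
        forall x, W x -> exists d (p q : mpoly.mpoly n.+1 k),
          [/\ homog d p, homog d q, mpoly.meval (phi x) q <> 0 &
          forall y, W y -> mpoly.meval (phi y) q <> 0 ->
            f y = mpoly.meval (phi y) p / mpoly.meval (phi y) q])].

(* Smooth projective curves, possibly disconnected. *)
Record pcurve := PCurve {
  pspace :> kspace;
  pcurve_projective : is_projective pspace;
  pcurve_smooth : forall x : pspace, is_dvr (local_ring x) }.

(* Smooth projective curves, connected. *)
Record curve := Curve {
  curve_pcurve :> pcurve;
  curve_nonempty : [set: pts curve_pcurve] !=set0;
  curve_connected : connected [set: pts curve_pcurve] }.

Definition finite_morphism (Y X : kspace) (f : smorphism Y X) : Prop :=
  forall x : X, exists U : set X,
  [/\ U x, affine_open U, affine_open (f @^-1` U) &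
    exists (n : nat) (b : 'I_n -> Y -> k),
      (forall i, reg (f @^-1` U) (b i)) /\
      forall h, reg (f @^-1` U) h -> exists a : 'I_n -> X -> k,
        (forall i, reg U (a i)) /\
        forall y, U (f y) -> h y = \sum_i a i (f y) * b i y].

(* For smooth curves over an algebraically closed field, f is etale at y iff
   the maximal ideal at f(y) generates the maximal ideal at y. *)
Definition etale_at (Y X : pcurve) (f : smorphism Y X) (y : Y) : Prop :=
  exists2 p : local_ring (f y),
    is_uniformizer p & is_uniformizer (germ_pull p).

Definition is_covering (Y X : pcurve) (f : smorphism Y X) : Prop :=
  finite_morphism f /\
  exists U : set Y, [/\ open U, dense U & forall y, U y -> etale_at f y].

Section FibreProduct.
Variables (X Y S : kspace) (f : smorphism X S) (g : smorphism Y S).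

Record fp_pts := FpPts { fp1 : X; fp2 : Y; fpE : f fp1 = g fp2 }.
HB.instance Definition _ := gen_eqMixin fp_pts.
HB.instance Definition _ := gen_choiceMixin fp_pts.

(* The functions sum_i a_i(x) b_i(y), with a_i regular on U and b_i regular
   on V. *)
Inductive fp_fun (U : set X) (V : set Y) : (fp_pts -> k) -> Prop :=
| fp_fun1 a : reg U a -> fp_fun U V (fun z => a (fp1 z))
| fp_fun2 b : reg V b -> fp_fun U V (fun z => b (fp2 z))
| fp_funD h h' : fp_fun U V h -> fp_fun U V h' ->
    fp_fun U V (fun z => h z + h' z)
| fp_funM h h' : fp_fun U V h -> fp_fun U V h' ->
    fp_fun U V (fun z => h z * h' z).

Definition fp_box (U : set X) (V : set Y) : set fp_pts :=
  [set z | U (fp1 z) /\ V (fp2 z)].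

Definition fp_open (W : set fp_pts) : Prop :=
  forall z, W z -> exists U V h, [/\ open U /\ open V, fp_box U V z,
    fp_fun U V h, h z <> 0 & forall z', fp_box U V z' -> h z' <> 0 -> W z'].

Lemma fp_fun_sub (U U' : set X) (V V' : set Y) h :
  open U -> open U' -> open V -> open V' -> U' `<=` U -> V' `<=` V ->
  fp_fun U V h -> fp_fun U' V' h.
Proof.
move=> oU oU' oV oV' sU sV; elim=> [a ra|b rb|h1 h2 _ ? _ ?|h1 h2 _ ? _ ?].
- by apply: fp_fun1; exact: (reg_sub oU).
- by apply: fp_fun2; exact: (reg_sub oV).
- exact: fp_funD.
- exact: fp_funM.
Qed.

Lemma fp_fun_cst (U : set X) (V : set Y) c :
  open U -> fp_fun U V (fun=> c).
Proof. by move=> oU; apply: (@fp_fun1 U V (fun=> c)); exact: reg_cst. Qed.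

Lemma fp_openT : fp_open setT.
Proof.
move=> z _; exists setT, setT, (fun=> 1); split => //.
- by split; exact: openT.
- by apply: fp_fun_cst; exact: openT.
- by apply/eqP; rewrite oner_eq0.
Qed.

Lemma fp_openI : setI_closed fp_open.
Proof.
move=> A B oA oB z [Az Bz].
have [U [V [h [[oU oV] [Uz Vz] hf hz hA]]]] := oA _ Az.
have [U' [V' [h' [[oU' oV'] [Uz' Vz'] hf' hz' hB]]]] := oB _ Bz.
have oUU := openI oU oU'; have oVV := openI oV oV'.
exists (U `&` U'), (V `&` V'), (fun z => h z * h' z); split => //.
- apply: fp_funM.
  + by apply: fp_fun_sub hf => //; exact: subIsetl.
  + by apply: fp_fun_sub hf' => //; exact: subIsetr.
- by apply/eqP; rewrite mulf_neq0 //; exact/eqP.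
- move=> z' [[? ?] [? ?]] /eqP; rewrite mulf_eq0 negb_or => /andP[/eqP ? /eqP ?].
  by split; [exact: hA|exact: hB].
Qed.

Lemma fp_open_bigU (I : Type) (F : I -> set fp_pts) :
  (forall i, fp_open (F i)) -> fp_open (\bigcup_i F i).
Proof.
move=> oF z [i _ Fz]; have [U [V [h [oUV bz hf hz hF]]]] := oF i z Fz.
exists U, V, h; split => // z' bz' hz'; exists i => //; exact: hF.
Qed.

HB.instance Definition _ :=
  isOpenTopological.Build fp_pts fp_openT fp_openI fp_open_bigU.

Lemma fp_openE (W : set fp_pts) : open W <-> fp_open W.
Proof. by []. Qed.

Definition fp_reg (W : set fp_pts) (r : fp_pts -> k) : Prop :=
  forall z, W z -> exists U V h h', [/\ open U /\ open V, fp_box U V z,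
    fp_fun U V h /\ fp_fun U V h', h' z <> 0 &
    forall z', W z' -> fp_box U V z' -> h' z' <> 0 -> r z' = h z' / h' z'].

Let common (W : set fp_pts) (r r' : fp_pts -> k) z : fp_reg W r ->
  fp_reg W r' -> W z -> exists U V a b a' b',
  [/\ open U /\ open V, fp_box U V z,
    [/\ fp_fun U V a, fp_fun U V b, fp_fun U V a' & fp_fun U V b'],
    b z <> 0 /\ b' z <> 0 &
    forall z', W z' -> fp_box U V z' -> b z' <> 0 -> b' z' <> 0 ->
      r z' = a z' / b z' /\ r' z' = a' z' / b' z'].
Proof.
move=> hr hr' Wz.
have [U [V [a [b [[oU oV] [Uz Vz] [ha hb] hz e]]]]] := hr _ Wz.
have [U' [V' [a' [b' [[oU' oV'] [Uz' Vz'] [ha' hb'] hz' e']]]]] := hr' _ Wz.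
have oUU := openI oU oU'; have oVV := openI oV oV'.
exists (U `&` U'), (V `&` V'), a, b, a', b'; split => //.
- by split; [apply: fp_fun_sub ha|apply: fp_fun_sub hb|
    apply: fp_fun_sub ha'|apply: fp_fun_sub hb'] => //;
    do ?[exact: subIsetl|exact: subIsetr].
- move=> z' Wz' [[? ?] [? ?]] bz bz'; split; [exact: e|exact: e'].
Qed.

Let nzM (a b : k) : a * b <> 0 <-> a <> 0 /\ b <> 0.
Proof.
split=> [/eqP|[/eqP ? /eqP ?]]; last by apply/eqP; rewrite mulf_neq0.
by rewrite mulf_eq0 negb_or => /andP[/eqP ? /eqP].
Qed.

Let fp_reg_cst (W : set fp_pts) (c : k) : open W -> fp_reg W (fun=> c).
Proof.
move=> _ z _; exists setT, setT, (fun=> c), (fun=> 1); split => //.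
- by split; exact: openT.
- by split; apply: fp_fun_cst; exact: openT.
- by apply/eqP; rewrite oner_eq0.
- by move=> *; rewrite divr1.
Qed.

Let fp_reg_add (W : set fp_pts) r r' : open W -> fp_reg W r -> fp_reg W r' ->
  fp_reg W (fun z => r z + r' z).
Proof.
move=> _ hr hr' z Wz.
have [U [V [a [b [a' [b' [oUV bz [ha hb ha' hb'] [nz nz'] e]]]]]]] :=
  common hr hr' Wz.
exists U, V, (fun z => a z * b' z + a' z * b z), (fun z => b z * b' z).
split => //.
- by split; do ?[apply: fp_funM|apply: fp_funD] => //; apply: fp_funM.
- exact/nzM.
- move=> z' Wz' bz' /nzM [h h']; have [-> ->] := e _ Wz' bz' h h'.
  by field; do ?[apply/andP; split]; exact/eqP.
Qed.

Let fp_reg_mul (W : set fp_pts) r r' : open W -> fp_reg W r -> fp_reg W r' ->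
  fp_reg W (fun z => r z * r' z).
Proof.
move=> _ hr hr' z Wz.
have [U [V [a [b [a' [b' [oUV bz [ha hb ha' hb'] [nz nz'] e]]]]]]] :=
  common hr hr' Wz.
exists U, V, (fun z => a z * a' z), (fun z => b z * b' z).
split => //.
- by split; apply: fp_funM.
- exact/nzM.
- move=> z' Wz' bz' /nzM [h h']; have [-> ->] := e _ Wz' bz' h h'.
  by field; do ?[apply/andP; split]; exact/eqP.
Qed.

Let fp_reg_local (W : set fp_pts) r : open W ->
  (fp_reg W r <-> forall z, W z -> exists (V : set fp_pts) g,
    [/\ open V, V z, fp_reg V g & forall y, V y -> W y -> r y = g y]).
Proof.
move=> oW; split=> [hr z Wz|h z Wz]; first by exists W, r.
have [A [s [oA Az hs rs]]] := h z Wz.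
have [U [V [a [b [[oU oV] [Uz Vz] [ha hb] nz e]]]]] := hs _ Az.
have [U' [V' [c [[oU' oV'] [Uz' Vz'] hc nz' hA]]]] := oA _ Az.
have oUU := openI oU oU'; have oVV := openI oV oV'.
have ha' : fp_fun (U `&` U') (V `&` V') a.
  by apply: fp_fun_sub ha => //; exact: subIsetl.
have hb' : fp_fun (U `&` U') (V `&` V') b.
  by apply: fp_fun_sub hb => //; exact: subIsetl.
have hc' : fp_fun (U `&` U') (V `&` V') c.
  by apply: fp_fun_sub hc => //; exact: subIsetr.
exists (U `&` U'), (V `&` V'), (fun z => a z * c z), (fun z => b z * c z).
split => //.
- by split; apply: fp_funM.
- exact/nzM.
- move=> z' Wz' [[? ?] [? ?]] /nzM [bz cz].
  have Az' : A z' by exact: hA.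
  rewrite rs // e //; by field; do ?[apply/andP; split]; exact/eqP.
Qed.

Let fp_reg_nz (W : set fp_pts) r : open W -> fp_reg W r ->
  open [set z | W z /\ r z <> 0].
Proof.
move=> oW hr; apply/fp_openE => z [Wz rz].
have [U [V [a [b [[oU oV] [Uz Vz] [ha hb] nz e]]]]] := hr _ Wz.
have [U' [V' [c [[oU' oV'] [Uz' Vz'] hc nz' hA]]]] := oW _ Wz.
have oUU := openI oU oU'; have oVV := openI oV oV'.
have az : a z <> 0 by move=> a0; apply: rz; rewrite e // a0 mul0r.
exists (U `&` U'), (V `&` V'), (fun z => a z * (b z * c z)); split => //.
- apply: fp_funM; last apply: fp_funM.
  + by apply: fp_fun_sub ha => //; exact: subIsetl.
  + by apply: fp_fun_sub hb => //; exact: subIsetl.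
  + by apply: fp_fun_sub hc => //; exact: subIsetr.
- by apply/nzM; split => //; exact/nzM.
- move=> z' [[? ?] [? ?]] /nzM [az' /nzM [bz' cz']].
  have Wz' : W z' by exact: hA.
  split => //; rewrite e //; apply/nzM; split => //.
  by apply/eqP; rewrite invr_eq0; exact/eqP.
Qed.

Let fp_reg_inv (W : set fp_pts) r : open W -> fp_reg W r ->
  (forall z, W z -> r z <> 0) -> fp_reg W (fun z => (r z)^-1).
Proof.
move=> oW hr rnz z Wz.
have [U [V [a [b [[oU oV] [Uz Vz] [ha hb] nz e]]]]] := hr _ Wz.
have az : a z <> 0 by move=> a0; apply: (rnz _ Wz); rewrite e // a0 mul0r.
exists U, V, (fun z => b z * b z), (fun z => a z * b z); split => //.
- by split; apply: fp_funM.
- exact/nzM.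
- move=> z' Wz' bz' /nzM [h h']; rewrite e //.
  by field; do ?[apply/andP; split]; exact/eqP.
Qed.

Definition fibre_product : kspace := @Space fp_pts fp_reg fp_reg_cst
  fp_reg_add fp_reg_mul fp_reg_local fp_reg_nz fp_reg_inv.

Let fp1_cont (U : set X) : open U -> open ((fp1 : fibre_product -> X) @^-1` U).
Proof.
move=> oU; apply/fp_openE => z Uz; exists U, setT, (fun=> 1); split => //.
- by split => //; exact: openT.
- exact: fp_fun_cst.
- by apply/eqP; rewrite oner_eq0.
- by move=> z' [].
Qed.
Let fp2_cont (U : set Y) : open U -> open ((fp2 : fibre_product -> Y) @^-1` U).
Proof.
move=> oU; apply/fp_openE => z Uz; exists setT, U, (fun=> 1); split => //.
- by split => //; exact: openT.
- by apply: fp_fun_cst; exact: openT.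
- by apply/eqP; rewrite oner_eq0.
- by move=> z' [].
Qed.
Let fp1_reg (U : set X) a : open U -> reg U a ->
  reg ((fp1 : fibre_product -> X) @^-1` U) (a \o fp1).
Proof.
move=> oU ra z Uz; exists U, setT, (a \o fp1), (fun=> 1); split => //.
- by split => //; exact: openT.
- by split; [exact: fp_fun1|exact: fp_fun_cst].
- by apply/eqP; rewrite oner_eq0.
- by move=> *; rewrite divr1.
Qed.
Let fp2_reg (U : set Y) a : open U -> reg U a ->
  reg ((fp2 : fibre_product -> Y) @^-1` U) (a \o fp2).
Proof.
move=> oU ra z Uz; exists setT, U, (a \o fp2), (fun=> 1); split => //.
- by split => //; exact: openT.
- by split; [exact: fp_fun2|apply: fp_fun_cst; exact: openT].
- by apply/eqP; rewrite oner_eq0.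
- by move=> *; rewrite divr1.
Qed.

Definition fibre_proj1 : smorphism fibre_product X := Morphism fp1_cont fp1_reg.
Definition fibre_proj2 : smorphism fibre_product Y := Morphism fp2_cont fp2_reg.
End FibreProduct.

(* N is smooth, hence normal: nu is the normalization of W iff it is finite and
   birational. *)
Definition is_normalization (N : pcurve) (W : kspace) (nu : smorphism N W) :
  Prop :=
  finite_morphism nu /\
  exists W0 : set W, [/\ open W0, dense W0, dense (nu @^-1` W0),
    forall w, W0 w -> exists! n, nu n = w &
    forall A : set N, open A -> A `<=` nu @^-1` W0 -> open (nu @` A) /\
      forall r, reg A r -> exists2 s, reg (nu @` A) s &
        forall n, A n -> r n = s (nu n)].

Definition Kx (X : pcurve) (x : X) : fieldType :=
  fraction.FracField.type (completion (pcurve_smooth x)).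

Definition Kx_of (X : pcurve) (x : X) :
  completion (pcurve_smooth x) -> Kx x := @fraction.FracField.tofrac _.

Definition completion_pull (Y X : pcurve) (f : smorphism Y X) (y : Y)
  (a : completion (pcurve_smooth (f y))) : completion (pcurve_smooth y) :=
  completion_cl (pcurve_smooth y)
    (fun n => germ_pull (f := f) (completion_repr a n)).

Record branch_data (X : pcurve) := BranchData {
  bd_ext :> forall x : X, splittingFieldType (Kx x);
  bd_galois : forall x, galois 1%AS {:bd_ext x}%AS;
  bd_finite : finite_set [set x | {:bd_ext x}%VS != 1%VS] }.

(* Embeddings of P(f(y)) in Q(y) over K_{X,f(y)}; since K_{X,f(y)} is the
   fraction field of the completed local ring, it is enough to be over the
   latter. *)
Definition branch_embedding (Y X : pcurve) (Q : branch_data Y)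
    (P : branch_data X) (f : smorphism Y X) (y : Y)
    (j : {rmorphism P (f y) -> Q y}) : Prop :=
  forall a : completion (pcurve_smooth (f y)),
    j ((Kx_of a)%:A) = (Kx_of (completion_pull a))%:A.

Definition orbifold_morphism (Y X : pcurve) (Q : branch_data Y)
    (P : branch_data X) (f : smorphism Y X) : Prop :=
  is_covering f /\
  forall y, exists j : {rmorphism P (f y) -> Q y}, branch_embedding j.

Definition etale_orbifold_morphism (Y X : pcurve) (Q : branch_data Y)
    (P : branch_data X) (f : smorphism Y X) : Prop :=
  is_covering f /\
  forall y, exists2 j : {rmorphism P (f y) -> Q y},
    branch_embedding j & bijective j.

Section TrivialBranchData.
Variable X : pcurve.
Let triv (x : X) : splittingFieldType (Kx x) := (Kx x)^o.
Let triv_full (x : X) : {:triv x}%VS = 1%VS.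
Proof. exact: regular_fullv. Qed.
Let triv_galois (x : X) : galois 1%AS {:triv x}%AS.
Proof.
apply/and3P; split; first exact: subvf.
  change (separable (1%VS : {vspace triv x}) fullv).
  by rewrite (triv_full x); exact: separable_refl.
exact: normalFieldf.
Qed.
Let triv_finite : finite_set [set x | {:triv x}%VS != 1%VS].
Proof.
rewrite (_ : mkset _ = set0) ?finite_set0 //.
by apply/seteqP; split => // x /=; rewrite triv_full eqxx.
Qed.
Definition trivial_branch_data : branch_data X :=
  BranchData triv_galois triv_finite.
End TrivialBranchData.

Record formal_orbifold := FormalOrbifold {
  orb_curve :> curve;
  orb_branch : branch_data orb_curve }.

Definition etale_cover (X1 X2 : formal_orbifold) (f : smorphism X1 X2) : Prop :=
  etale_orbifold_morphism (orb_branch X1) (orb_branch X2) f.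

Definition curve_orbifold (Y : curve) : formal_orbifold :=
  FormalOrbifold (trivial_branch_data Y).

Definition is_geometric (X : formal_orbifold) : Prop :=
  exists (Y : curve) (f : smorphism (curve_orbifold Y) X), etale_cover f.

Record gaction (G : finGroupType) (Y : kspace) := Action {
  act_fun :> G -> smorphism Y Y;
  act_fun1 : forall y, act_fun 1%g y = y;
  act_funM : forall g h y, act_fun (g * h)%g y = act_fun g (act_fun h y) }.

Definition equivariant (G : finGroupType) (Y X : kspace)
    (aY : gaction G Y) (aX : gaction G X) (q : smorphism Y X) : Prop :=
  forall g y, q (aY g y) = aX g (q y).

(* G acts faithfully on Y over X and k(Y)^G = k(X), i.e. k(Y)/k(X) is Galois
   with group G. *)
Definition galois_covering (G : finGroupType) (Y X : curve)
    (aY : gaction G Y) (f : smorphism Y X) : Prop :=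
  [/\ is_covering f,
      forall g y, f (aY g y) = f y,
      forall g, (forall y, aY g y = y) -> g = 1%g &
      forall (U : set Y) r, open U -> U !=set0 -> reg U r ->
        (forall g y, U y -> U (aY g y) /\ r (aY g y) = r y) ->
        exists (V : set X) s, [/\ open V, V !=set0, reg V s &
          forall y, U y -> V (f y) -> r y = s (f y)]].

Definition etale_galois_cover (G : finGroupType) (Y : curve)
    (X : formal_orbifold) (aY : gaction G Y) (f : smorphism Y X) : Prop :=
  etale_cover (f : smorphism (curve_orbifold Y) X) /\ galois_covering aY f.
End Spaces.

(* The quotient of the free abelian group on T by the formal sums which are
   killed by all maps phi satisfying adm.  When adm expresses additive relations
   between the values of phi, this is the abelian group generated by T subject
   to these relations.  A pair (true, t) stands for -t. *)
Section Generated.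
Variables (T : Type) (adm : forall A : zmodType, (T -> A) -> Prop).

Definition fsum (A : zmodType) (phi : T -> A) (s : seq (bool * T)) : A :=
  \sum_(x <- s) (if x.1 then - phi x.2 else phi x.2).

Definition gen_eqv (s t : seq (bool * T)) : Prop :=
  forall (A : zmodType) (phi : T -> A), adm phi -> fsum phi s = fsum phi t.

Let gR s : gen_eqv s s. Proof. by []. Qed.
Let gS s t : gen_eqv s t -> gen_eqv t s.
Proof. by move=> h A phi /h ->. Qed.
Let gT t s u : gen_eqv s t -> gen_eqv t u -> gen_eqv s u.
Proof. by move=> h h' A phi a; rewrite h ?h'. Qed.

Definition gen_group : Type := eclass gen_eqv.
Definition gcl (s : seq (bool * T)) : gen_group := ecl gen_eqv s.
Definition grepr (c : gen_group) : seq (bool * T) := erepr c.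

Definition gev (A : zmodType) (phi : T -> A) (c : gen_group) : A :=
  fsum phi (grepr c).

Lemma gev_cl (A : zmodType) (phi : T -> A) s :
  adm phi -> gev phi (gcl s) = fsum phi s.
Proof. by move=> h; exact: (erepr_cl gR gS gT). Qed.

Lemma genP (c d : gen_group) :
  (forall (A : zmodType) (phi : T -> A), adm phi -> gev phi c = gev phi d) ->
  c = d.
Proof.
by move=> h; rewrite -(ereprK c) -(ereprK d); apply/(eclP gR gS gT) => A phi /h.
Qed.

Let gadd (c d : gen_group) := gcl (grepr c ++ grepr d).
Let gopp (c : gen_group) := gcl [seq (~~ x.1, x.2) | x <- grepr c].

Let gev_add' (A : zmodType) (phi : T -> A) c d : adm phi ->
  gev phi (gadd c d) = gev phi c + gev phi d.
Proof. by move=> h; rewrite gev_cl // /fsum big_cat. Qed.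
Let gev_opp' (A : zmodType) (phi : T -> A) c : adm phi ->
  gev phi (gopp c) = - gev phi c.
Proof.
move=> h; rewrite gev_cl // /gev /fsum big_map -sumrN; apply: eq_bigr.
by move=> [[] t] _ /=; rewrite ?opprK.
Qed.
Let gev_0' (A : zmodType) (phi : T -> A) : adm phi -> gev phi (gcl [::]) = 0.
Proof. by move=> h; rewrite gev_cl // /fsum big_nil. Qed.

Let gaddA : associative gadd.
Proof. by move=> x y z; apply: genP => A phi h; rewrite !gev_add' // addrA. Qed.
Let gaddC : commutative gadd.
Proof. by move=> x y; apply: genP => A phi h; rewrite !gev_add' // addrC. Qed.
Let gadd0 : left_id (gcl [::]) gadd.
Proof.
by move=> x; apply: genP => A phi h; rewrite !gev_add' // gev_0' // add0r.
Qed.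
Let gaddN : left_inverse (gcl [::]) gopp gadd.
Proof.
move=> x; apply: genP => A phi h.
by rewrite gev_add' // gev_opp' // gev_0' // addNr.
Qed.

HB.instance Definition _ := gen_eqMixin gen_group.
HB.instance Definition _ := gen_choiceMixin gen_group.
HB.instance Definition _ := GRing.isZmodule.Build gen_group gaddA gaddC gadd0 gaddN.

Lemma gevD (A : zmodType) (phi : T -> A) c d : adm phi ->
  gev phi (c + d) = gev phi c + gev phi d.
Proof. exact: gev_add'. Qed.

Lemma gev_ext (A : zmodType) (phi psi : T -> A) c :
  (forall t, phi t = psi t) -> gev phi c = gev psi c.
Proof. by move=> h; apply: eq_bigr => x _; rewrite h. Qed.

Lemma gev_addf (A : zmodType) (phi psi : T -> A) c :
  gev (fun t => phi t + psi t) c = gev phi c + gev psi c.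
Proof.
rewrite /gev /fsum -big_split; apply: eq_bigr => -[[] t] _ //=.
by rewrite opprD.
Qed.
End Generated.

Arguments gen_group : clear implicits.

Section GenMap.
Variables (T T' : Type) (adm : forall A : zmodType, (T -> A) -> Prop)
  (adm' : forall A : zmodType, (T' -> A) -> Prop) (h : T -> T').

Definition gmap (c : gen_group T adm) : gen_group T' adm' :=
  gcl adm' [seq (x.1, h x.2) | x <- grepr c].

Lemma gev_map (A : zmodType) (phi : T' -> A) c : adm' phi ->
  gev phi (gmap c) = gev (phi \o h) c.
Proof. by move=> hphi; rewrite gev_cl // /fsum big_map. Qed.

Lemma gmapD c d :
  (forall (A : zmodType) (phi : T' -> A), adm' phi -> adm (phi \o h)) ->
  gmap (c + d) = gmap c + gmap d.
Proof.
move=> H; apply: genP => A phi hphi.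
by rewrite gevD // !gev_map // gevD //; exact: H.
Qed.
End GenMap.

Section Modules.
Variable k : closedFieldType.

Section EqMod.
Variables (G : finGroupType) (X : kspace k) (a : gaction G X).

(* G-equivariant presheaves of O_X-modules.  Sections, restrictions (only
   meaningful to smaller sets) and multiplication by functions (only meaningful
   for regular functions) are total operations; all axioms are about open sets.
   The isomorphism lambda_g : g^*M -> M is given by the corresponding semilinear
   maps M(U) -> M(g^-1 U).  With the cocycle condition, the invertibility of
   all lambda_g amounts to lambda_1 = id. *)
Record eqmod_axioms (sec : set X -> zmodType)
    (res : forall U V : set X, sec U -> sec V)
    (scal : forall U : set X, (X -> k) -> sec U -> sec U)
    (lam : forall (g : G) (U : set X), sec U -> sec (a g @^-1` U)) : Prop := {
  res_addP : forall U V : set X, open U -> open V -> V `<=` U ->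
    forall m n, res U V (m + n) = res U V m + res U V n;
  res_idP : forall U : set X, open U -> forall m, res U U m = m;
  res_compP : forall U V W : set X, open U -> open V -> open W ->
    V `<=` U -> W `<=` V -> forall m, res V W (res U V m) = res U W m;
  scal_addrP : forall U r, open U -> reg U r ->
    forall m n, scal U r (m + n) = scal U r m + scal U r n;
  scal_addlP : forall U r s, open U -> reg U r -> reg U s ->
    forall m, scal U (fun x => r x + s x) m = scal U r m + scal U s m;
  scal_mulP : forall U r s, open U -> reg U r -> reg U s ->
    forall m, scal U (fun x => r x * s x) m = scal U r (scal U s m);
  scal_1P : forall U, open U -> forall m, scal U (fun=> 1) m = m;
  scal_extP : forall U r s, open U -> reg U r -> reg U s ->
    (forall x, U x -> r x = s x) -> forall m, scal U r m = scal U s m;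
  res_scalP : forall (U V : set X) r, open U -> open V -> V `<=` U ->
    reg U r -> forall m, res U V (scal U r m) = scal V r (res U V m);
  lam_addP : forall g U, open U ->
    forall m n, lam g U (m + n) = lam g U m + lam g U n;
  lam_scalP : forall g U r, open U -> reg U r ->
    forall m, lam g U (scal U r m) = scal _ (r \o a g) (lam g U m);
  lam_resP : forall g (U V : set X), open U -> open V -> V `<=` U ->
    forall m, lam g V (res U V m) = res _ _ (lam g U m);
  lam_1P : forall U, open U -> forall m, lam 1%g U m = res _ _ m;
  lam_mulP : forall g h U, open U ->
    forall m, lam (g * h)%g U m = res _ _ (lam h _ (lam g U m)) }.

Record eqmod := EqMod {
  sec :> set X -> zmodType;
  res : forall U V : set X, sec U -> sec V;
  scal : forall U : set X, (X -> k) -> sec U -> sec U;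
  lam : forall (g : G) (U : set X), sec U -> sec (a g @^-1` U);
  eqmodP : eqmod_axioms res scal lam }.

Definition is_sheaf (M : eqmod) : Prop :=
  forall (I : Type) (U : I -> set X), (forall i, open (U i)) ->
    let W := \bigcup_i U i in
    (forall m n : M W, (forall i, res (U i) m = res (U i) n) -> m = n) /\
    (forall m : forall i, M (U i),
      (forall i j, res (U i `&` U j) (m i) = res (U i `&` U j) (m j)) ->
      exists n : M W, forall i, res (U i) n = m i).

Definition locally_free (M : eqmod) : Prop :=
  forall x : X, exists U : set X, [/\ open U, U x &
    exists (n : nat) (e : 'I_n -> M U),
      forall V : set X, open V -> V `<=` U ->
        (forall m : M V, exists r : 'I_n -> X -> k,
          (forall i, reg V (r i)) /\ m = \sum_i scal (r i) (res V (e i))) /\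
        (forall r : 'I_n -> X -> k, (forall i, reg V (r i)) ->
          \sum_i scal (r i) (res V (e i)) = 0 ->
          forall i x, V x -> r i x = 0)].

(* Vector bundles are identified with their sheaves of sections. *)
Record bundle := Bundle {
  bundle_mod :> eqmod;
  bundle_sheaf : is_sheaf bundle_mod;
  bundle_free : locally_free bundle_mod }.

Definition eqmod_iso (M N : eqmod) : Prop :=
  exists phi : forall U : set X, M U -> N U,
    forall U : set X, open U ->
    [/\ (forall m n, phi U (m + n) = phi U m + phi U n) /\
        (forall r m, reg U r -> phi U (scal r m) = scal r (phi U m)),
        forall V m, open V -> V `<=` U -> phi V (res V m) = res V (phi U m),
        forall g m, phi _ (lam g m) = lam g (phi U m) &
        bijective (phi U)].

Section Theory.
Variable M : eqmod.

Lemma resD (U V : set X) (m n : M U) : open U -> open V -> V `<=` U ->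
  res V (m + n) = res V m + res V n.
Proof. by move=> oU oV VU; exact: (res_addP (eqmodP M)). Qed.
Lemma res_id (U : set X) (m : M U) : open U -> res U m = m.
Proof. by move=> oU; exact: (res_idP (eqmodP M)). Qed.
Lemma res_comp (U V W : set X) (m : M U) : open U -> open V -> open W ->
  V `<=` U -> W `<=` V -> res W (res V m) = res W m.
Proof. by move=> *; exact: (res_compP (eqmodP M)). Qed.
Lemma scalDr (U : set X) r (m n : M U) : open U -> reg U r ->
  scal r (m + n) = scal r m + scal r n.
Proof. by move=> *; exact: (scal_addrP (eqmodP M)). Qed.
Lemma scalDl (U : set X) r s (m : M U) : open U -> reg U r -> reg U s ->
  scal (fun x => r x + s x) m = scal r m + scal s m.
Proof. by move=> *; exact: (scal_addlP (eqmodP M)). Qed.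
Lemma scalM (U : set X) r s (m : M U) : open U -> reg U r -> reg U s ->
  scal (fun x => r x * s x) m = scal r (scal s m).
Proof. by move=> *; exact: (scal_mulP (eqmodP M)). Qed.
Lemma scal1 (U : set X) (m : M U) : open U -> scal (fun=> 1) m = m.
Proof. by move=> *; exact: (scal_1P (eqmodP M)). Qed.
Lemma scal_ext (U : set X) r s (m : M U) : open U -> reg U r -> reg U s ->
  (forall x, U x -> r x = s x) -> scal r m = scal s m.
Proof. by move=> *; exact: (scal_extP (eqmodP M)). Qed.
Lemma res_scal (U V : set X) r (m : M U) : open U -> open V -> V `<=` U ->
  reg U r -> res V (scal r m) = scal r (res V m).
Proof. by move=> *; exact: (res_scalP (eqmodP M)). Qed.
Lemma lamD g (U : set X) (m n : M U) : open U ->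
  lam g (m + n) = lam g m + lam g n.
Proof. by move=> *; exact: (lam_addP (eqmodP M)). Qed.
Lemma lam_scal g (U : set X) r (m : M U) : open U -> reg U r ->
  lam g (scal r m) = scal (r \o a g) (lam g m).
Proof. by move=> *; exact: (lam_scalP (eqmodP M)). Qed.
Lemma lam_res g (U V : set X) (m : M U) : open U -> open V -> V `<=` U ->
  lam g (res V m) = res (a g @^-1` V) (lam g m).
Proof. by move=> *; exact: (lam_resP (eqmodP M)). Qed.
Lemma lam1 (U : set X) (m : M U) : open U -> lam 1%g m = res _ m.
Proof. by move=> *; exact: (lam_1P (eqmodP M)). Qed.
Lemma lamM g h (U : set X) (m : M U) : open U ->
  lam (g * h)%g m = res _ (lam h (lam g m)).
Proof. by move=> *; exact: (lam_mulP (eqmodP M)). Qed.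
Lemma res0 (U V : set X) : open U -> open V -> V `<=` U ->
  res V (0 : M U) = 0.
Proof.
move=> oU oV VU; apply: (@addrI _ (res V (0 : M U))).
by rewrite -resD // !addr0.
Qed.
Lemma scal0 (U : set X) r : open U -> reg U r -> scal r (0 : M U) = 0.
Proof.
move=> oU rU; apply: (@addrI _ (scal r (0 : M U))).
by rewrite -scalDr // !addr0.
Qed.
Lemma lam0 g (U : set X) : open U -> lam g (0 : M U) = 0.
Proof.
move=> oU; apply: (@addrI _ (lam g (0 : M U))).
by rewrite -lamD // !addr0.
Qed.

Lemma act1_preim (U : set X) : a 1%g @^-1` U = U.
Proof. by apply/funext => x; rewrite /preimage /= act_fun1. Qed.
Lemma actM_preim g h (U : set X) :
  a (g * h)%g @^-1` U = a h @^-1` (a g @^-1` U).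
Proof. by apply/funext => x; rewrite /preimage /= act_funM. Qed.
End Theory.
End EqMod.

Section Push.
Variables (G : finGroupType) (Y X : kspace k) (aY : gaction G Y)
  (aX : gaction G X) (q : smorphism Y X) (hq : equivariant aY aX q)
  (M : eqmod aY).

Lemma equi_preim g (U : set X) : q @^-1` (aX g @^-1` U) = aY g @^-1` (q @^-1` U).
Proof. by apply/funext => y; rewrite /preimage /= hq. Qed.

Let psec (U : set X) : zmodType := M (q @^-1` U).
Let pres (U V : set X) (m : psec U) : psec V := res (q @^-1` V) m.
Let pscal (U : set X) (r : X -> k) (m : psec U) : psec U := scal (r \o q) m.
Let plam (g : G) (U : set X) (m : psec U) : psec (aX g @^-1` U) :=
  res (q @^-1` (aX g @^-1` U)) (lam g m).

Let pushP : eqmod_axioms pres pscal plam.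
Proof.
have oq (U : set X) : open U -> open (q @^-1` U) := @mcont _ _ _ q U.
have og g (U : set X) : open U -> open (aX g @^-1` U) := @mcont _ _ _ (aX g) U.
have oy g (U : set Y) : open U -> open (aY g @^-1` U) := @mcont _ _ _ (aY g) U.
have sq (U V : set X) : V `<=` U -> q @^-1` V `<=` q @^-1` U.
  by move=> VU y /VU.
have sy g (U V : set Y) : V `<=` U -> aY g @^-1` V `<=` aY g @^-1` U.
  by move=> VU y /VU.
have rq (U : set X) r : open U -> reg U r -> reg (q @^-1` U) (r \o q).
  exact: mreg.
have se g (U : set X) : q @^-1` (aX g @^-1` U) `<=` aY g @^-1` (q @^-1` U).
  by rewrite equi_preim.
split; rewrite /psec /pres /pscal /plam.
- by move=> U V oU oV VU m n; apply: resD; [exact: oq|exact: oq|exact: sq].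
- by move=> U oU m; apply: res_id; exact: oq.
- by move=> U V W oU oV oW VU WV m; apply: res_comp; do ?[exact: oq|exact: sq].
- by move=> U r oU rU m n; apply: scalDr; [exact: oq|exact: rq].
- by move=> U r s oU rU sU m; apply: scalDl; [exact: oq|exact: rq|exact: rq].
- by move=> U r s oU rU sU m; apply: scalM; [exact: oq|exact: rq|exact: rq].
- by move=> U oU m; apply: scal1; exact: oq.
- move=> U r s oU rU sU rs m; apply: scal_ext; [exact: oq|exact: rq|exact: rq|].
  by move=> x Ux; exact: rs.
- move=> U V r oU oV VU rU m.
  by apply: res_scal; [exact: oq|exact: oq|exact: sq|exact: rq].
- move=> g U oU m n; rewrite lamD ?resD //; do ?[exact: oq|exact: oy|exact: og].
  + by apply: (oy); exact: oq.
  + by apply: (oq); exact: og.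
- move=> g U r oU rU m; rewrite lam_scal ?res_scal //.
  + apply: scal_ext.
    * by apply: (oq); exact: og.
    * rewrite equi_preim; apply: (@mreg _ _ _ (aY g)); first exact: oq.
      exact: rq.
    * apply: (rq _ (r \o aX g)); first exact: og.
      exact: mreg.
    * by move=> y _ /=; rewrite hq.
  + by apply: (oy); exact: oq.
  + by apply: (oq); exact: og.
  + by apply: mreg; [exact: oq|exact: rq].
  + exact: oq.
  + exact: rq.
- move=> g U V oU oV VU m; rewrite lam_res; do ?[exact: oq|exact: sq].
  rewrite !res_comp //; do ?[by apply: (oy); exact: oq|by apply: (oq); exact: og].
  + by move=> y /VU.
  + by apply: sy; exact: sq.
- move=> U oU m; rewrite lam1; last exact: oq.
  rewrite res_comp //; do ?[by apply: (oy); exact: oq|by apply: (oq); exact: og].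
  + exact: oq.
  + by rewrite act1_preim.
- move=> g h U oU m; have o0 := oq _ oU.
  have o6 : open (aY g @^-1` (q @^-1` U)) by exact: oy.
  have o7 : open (q @^-1` (aX g @^-1` U)) by apply: (oq); exact: og.
  have o1 : open (aY h @^-1` (aY g @^-1` (q @^-1` U))).
    by apply: (oy); apply: (oy); exact: oq.
  have o2 : open (aY h @^-1` (q @^-1` (aX g @^-1` U))).
    by apply: (oy); apply: (oq); exact: og.
  have o3 : open (q @^-1` (aX h @^-1` (aX g @^-1` U))).
    by apply: (oq); apply: (og); exact: og.
  have o4 : open (q @^-1` (aX (g * h)%g @^-1` U)) by apply: (oq); exact: og.
  have o5 : open (aY (g * h)%g @^-1` (q @^-1` U)) by apply: (oy); exact: oq.
  rewrite lamM // (lam_res _ _ o6 o7 (se _ _)).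
  by rewrite !res_comp // => y; rewrite /preimage /= ?act_funM ?hq ?act_funM ?hq.
Qed.

Definition direct_image : eqmod aX := EqMod pushP.
End Push.

Section TensorPresheaf.
Variables (G : finGroupType) (X : kspace k) (a : gaction G X) (M N : eqmod a).

Definition tensor_adm (U : set X) (A : zmodType) (phi : M U * N U -> A) : Prop :=
  [/\ forall m m' n, phi (m + m', n) = phi (m, n) + phi (m', n),
      forall m n n', phi (m, n + n') = phi (m, n) + phi (m, n') &
      forall r m n, reg U r -> phi (scal r m, n) = phi (m, scal r n)].

Let tsec (U : set X) : zmodType := gen_group _ (@tensor_adm U).
Let hres (U V : set X) (t : M U * N U) : M V * N V := (res V t.1, res V t.2).
Let hscal (U : set X) r (t : M U * N U) : M U * N U := (scal r t.1, t.2).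
Let hlam g (U : set X) (t : M U * N U) := (lam g t.1, lam g t.2).
Let tres (U V : set X) (c : tsec U) : tsec V := gmap _ (@hres U V) c.
Let tscal (U : set X) r (c : tsec U) : tsec U := gmap _ (@hscal U r) c.
Let tlam g (U : set X) (c : tsec U) : tsec (a g @^-1` U) := gmap _ (@hlam g U) c.

Let adm_res (U V : set X) : open U -> open V -> V `<=` U ->
  forall (A : zmodType) (phi : M V * N V -> A), tensor_adm phi ->
  tensor_adm (phi \o @hres U V).
Proof.
move=> oU oV VU A phi [h1 h2 h3]; split=> /=; rewrite /hres /=.
- by move=> m m' n; rewrite resD.
- by move=> m n n'; rewrite resD.
- by move=> r m n rU; rewrite !res_scal // h3 //; exact: reg_sub rU.
Qed.

Let adm_scal (U : set X) r : open U -> reg U r ->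
  forall (A : zmodType) (phi : M U * N U -> A), tensor_adm phi ->
  tensor_adm (phi \o @hscal U r).
Proof.
move=> oU rU A phi [h1 h2 h3]; split=> /=; rewrite /hscal /=.
- by move=> m m' n; rewrite scalDr.
- by move=> m n n'; rewrite h2.
- move=> s m n sU; rewrite -h3 // -!scalM //; congr (phi (_, _)).
  by apply: scal_ext => //; do ?[exact: reg_mul]; move=> x _; rewrite mulrC.
Qed.

Let adm_lam g (U : set X) : open U ->
  forall (A : zmodType) (phi : M (a g @^-1` U) * N (a g @^-1` U) -> A),
  tensor_adm phi -> tensor_adm (phi \o @hlam g U).
Proof.
move=> oU A phi [h1 h2 h3]; split=> /=; rewrite /hlam /=.
- by move=> m m' n; rewrite lamD.
- by move=> m n n'; rewrite lamD.
- by move=> r m n rU; rewrite !lam_scal // h3 //; exact: mreg.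
Qed.

Let tensorP : eqmod_axioms tres tscal tlam.
Proof.
have og g (U : set X) : open U -> open (a g @^-1` U) := @mcont _ _ _ (a g) U.
split; rewrite /tsec /tres /tscal /tlam.
- by move=> U V oU oV VU m n; apply: gmapD; exact: adm_res.
- move=> U oU m; apply: genP => A phi h; rewrite gev_map //.
  by apply: gev_ext => -[x y]; rewrite /hres /= !res_id.
- move=> U V W oU oV oW VU WV m; apply: genP => A phi h; rewrite !gev_map //.
    by apply: gev_ext => -[x y]; rewrite /hres /= !res_comp.
  exact: adm_res.
- by move=> U r oU rU m n; apply: gmapD; exact: adm_scal.
- move=> U r s oU rU sU m; apply: genP => A phi h.
  rewrite gevD // !gev_map // -gev_addf; apply: gev_ext => -[x y].
  by case: h => h1 h2 h3; rewrite /hscal /= scalDl // h1.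
- move=> U r s oU rU sU m; apply: genP => A phi h; rewrite !gev_map //.
    by apply: gev_ext => -[x y]; rewrite /hscal /= scalM.
  exact: adm_scal.
- move=> U oU m; apply: genP => A phi h; rewrite gev_map //.
  by apply: gev_ext => -[x y]; rewrite /hscal /= scal1.
- move=> U r s oU rU sU rs m; apply: genP => A phi h; rewrite !gev_map //.
  by apply: gev_ext => -[x y]; rewrite /hscal /= (scal_ext _ oU rU sU rs).
- move=> U V r oU oV VU rU m; apply: genP => A phi h.
  have rV := reg_sub oU oV VU rU.
  rewrite !gev_map //; do ?[exact: adm_res|exact: adm_scal].
  by apply: gev_ext => -[x y]; rewrite /hscal /hres /= res_scal.
- by move=> g U oU m n; apply: gmapD; exact: adm_lam.
- move=> g U r oU rU m; apply: genP => A phi h.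
  have rg := mreg (a g) oU rU.
  rewrite !gev_map //; do ?[exact: adm_lam|exact: adm_scal (og _ _ oU) rg _ _ h].
  by apply: gev_ext => -[x y]; rewrite /hscal /hlam /= lam_scal.
- move=> g U V oU oV VU m; apply: genP => A phi h.
  have s : a g @^-1` V `<=` a g @^-1` U by move=> y /VU.
  rewrite !gev_map //; do ?[exact: adm_lam|
    exact: adm_res (og _ _ oU) (og _ _ oV) s _ _ h].
  by apply: gev_ext => -[x y]; rewrite /hlam /hres /= !lam_res.
- move=> U oU m; apply: genP => A phi h; rewrite !gev_map //.
  by apply: gev_ext => -[x y]; rewrite /hlam /hres /= !lam1.
- move=> g h U oU m; apply: genP => A phi hphi.
  have s : a (g * h)%g @^-1` U `<=` a h @^-1` (a g @^-1` U).
    by rewrite actM_preim.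
  have o1 := og g _ oU; have o2 := og h _ o1; have o3 := og (g * h)%g _ oU.
  have h1 := adm_res o2 o3 s hphi; have h2 := adm_lam o1 h1.
  rewrite !gev_map //.
  by apply: gev_ext => -[x y]; rewrite /hlam /hres /= !lamM.
Qed.

(* U |-> M(U) (x)_{O(U)} N(U) *)
Definition tensor_presheaf : eqmod a := EqMod tensorP.
End TensorPresheaf.

Section PullPresheaf.
Variables (G : finGroupType) (Y X : kspace k) (aY : gaction G Y)
  (aX : gaction G X) (q : smorphism Y X) (hq : equivariant aY aX q)
  (M : eqmod aX).

(* [pull_mk m b] stands for the section b (x) m of the inverse image, where m is
   a section of M over a neighbourhood U of q(W) and b is regular on W. *)
Definition pull_gen : Type := {U : set X & (M U * (Y -> k))%type}.
Definition pull_mk (U : set X) (m : M U) (b : Y -> k) : pull_gen :=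
  existT (fun U : set X => (M U * (Y -> k))%type) U (m, b).

Definition pull_dom (W : set Y) (t : pull_gen) : Prop :=
  [/\ open (projT1 t), W `<=` q @^-1` (projT1 t) & reg W (projT2 t).2].

Record pull_rel (W : set Y) (A : zmodType) (phi : pull_gen -> A) : Prop := {
  pull_addm : forall (U : set X) (m m' : M U) b, pull_dom W (pull_mk m b) ->
    phi (pull_mk (m + m') b) = phi (pull_mk m b) + phi (pull_mk m' b);
  pull_addb : forall (U : set X) (m : M U) b b', pull_dom W (pull_mk m b) ->
    pull_dom W (pull_mk m b') ->
    phi (pull_mk m (fun y => b y + b' y)) =
      phi (pull_mk m b) + phi (pull_mk m b');
  pull_bal : forall (U : set X) (m : M U) b r, pull_dom W (pull_mk m b) ->
    reg U r -> phi (pull_mk (scal r m) b) =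
      phi (pull_mk m (fun y => r (q y) * b y));
  pull_res : forall (U V : set X) (m : M U) b, pull_dom W (pull_mk m b) ->
    open V -> V `<=` U -> W `<=` q @^-1` V ->
    phi (pull_mk (res V m) b) = phi (pull_mk m b);
  pull_ext : forall (U : set X) (m : M U) b b', pull_dom W (pull_mk m b) ->
    reg W b' -> (forall y, W y -> b y = b' y) ->
    phi (pull_mk m b) = phi (pull_mk m b') }.

Definition pull_adm (W : set Y) (A : zmodType) (phi : pull_gen -> A) : Prop :=
  pull_rel W phi /\ forall t, ~ pull_dom W t -> phi t = 0.

Let zg : pull_gen := @pull_mk setT 0 (fun=> 0).
Let trim (W : set Y) (t : pull_gen) : pull_gen :=
  if `[< pull_dom W t >] then t else zg.
Let trimT (W : set Y) t : pull_dom W t -> trim W t = t.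
Proof. by move=> h; rewrite /trim; case: asboolP. Qed.
Let trimF (W : set Y) t : ~ pull_dom W t -> trim W t = zg.
Proof. by move=> h; rewrite /trim; case: asboolP. Qed.

Let phi0 (W : set Y) (A : zmodType) (phi : pull_gen -> A) (U : set X) b :
  pull_adm W phi -> phi (@pull_mk U 0 b) = 0.
Proof.
move=> [h h0]; case: (pselect (pull_dom W (@pull_mk U 0 b))) => d.
  apply: (@addrI _ (phi (@pull_mk U 0 b))).
  by rewrite -(pull_addm h) // !addr0.
exact: h0.
Qed.

Let adm_trim (W : set Y) (A : zmodType) (phi : pull_gen -> A) : open W ->
  pull_rel W phi -> phi zg = 0 -> pull_adm W (phi \o trim W).
Proof.
move=> oW h hz; split; last by move=> t ht /=; rewrite trimF.
split.
- by move=> U m m' b d /=; rewrite !trimT //; exact: (pull_addm h).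
- move=> U m b b' d d' /=; rewrite !trimT //; first exact: (pull_addb h).
  by case: d d' => /= ? ? ? [? ? ?]; split => //; exact: reg_add.
- move=> U m b r d rU /=; rewrite !trimT //; first exact: (pull_bal h).
  case: d => /= oU WU bW; split => //=; apply: reg_mul => //.
  by apply: (@reg_sub _ _ (q @^-1` U)) => //; [exact: mcont|exact: mreg].
- move=> U V m b d oV VU WV /=; rewrite !trimT //; first exact: (pull_res h).
  by case: d.
- move=> U m b b' d b'W bb /=; rewrite !trimT //; first exact: (pull_ext h).
  by case: d.
Qed.

Let Fscal (r : Y -> k) (t : pull_gen) : pull_gen :=
  pull_mk (projT2 t).1 (fun y => r y * (projT2 t).2 y).
Let Flam g (t : pull_gen) : pull_gen :=
  pull_mk (lam g (projT2 t).1) ((projT2 t).2 \o aY g).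

Let psec (W : set Y) : zmodType := gen_group _ (@pull_adm W).
Let pres (W W' : set Y) (c : psec W) : psec W' := gmap _ (trim W) c.
Let pscal (W : set Y) r (c : psec W) : psec W := gmap _ (Fscal r \o trim W) c.
Let plam g (W : set Y) (c : psec W) : psec (aY g @^-1` W) :=
  gmap _ (Flam g \o trim W) c.

Let dom_res (W W' : set Y) t : open W -> open W' -> W' `<=` W ->
  pull_dom W t -> pull_dom W' t.
Proof.
move=> oW oW' s [oU WU bW]; split => //; last exact: reg_sub bW.
exact: subset_trans WU.
Qed.
Let dom_scal (W : set Y) r t : open W -> reg W r ->
  pull_dom W t -> pull_dom W (Fscal r t).
Proof. by move=> oW rW [oU WU bW]; split => //=; exact: reg_mul. Qed.
Let dom_lam g (W : set Y) t : open W ->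
  pull_dom W t -> pull_dom (aY g @^-1` W) (Flam g t).
Proof.
move=> oW [oU WU bW]; split => /=; first exact: mcont.
  by move=> y /WU; rewrite /preimage /= hq.
exact: mreg.
Qed.

Let Fscal0 r (W : set Y) (A : zmodType) (phi : pull_gen -> A) :
  pull_adm W phi -> phi (Fscal r zg) = 0.
Proof. exact: phi0. Qed.
Let Flam0 g (W : set Y) (A : zmodType) (phi : pull_gen -> A) :
  pull_adm W phi -> phi (Flam g zg) = 0.
Proof. by rewrite /Flam /= lam0; [exact: phi0|exact: openT]. Qed.

Let adm_res (W W' : set Y) : open W -> open W' -> W' `<=` W ->
  forall (A : zmodType) (phi : pull_gen -> A), pull_adm W' phi ->
  pull_adm W (phi \o trim W).
Proof.
move=> oW oW' s A phi h; apply: adm_trim => //; last exact: phi0 h.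
have D := dom_res oW oW' s; case: h => h _; split.
- by move=> *; apply: (pull_addm h); exact: D.
- by move=> *; apply: (pull_addb h); exact: D.
- by move=> *; apply: (pull_bal h) => //; exact: D.
- by move=> *; apply: (pull_res h) => //; [exact: D|exact: subset_trans s _].
- move=> U m b b' d b'W bb; apply: (pull_ext h); first exact: D.
    exact: reg_sub b'W.
  by move=> y /s; exact: bb.
Qed.

Let adm_scal (W : set Y) r : open W -> reg W r ->
  forall (A : zmodType) (phi : pull_gen -> A), pull_adm W phi ->
  pull_adm W (phi \o (Fscal r \o trim W)).
Proof.
move=> oW rW A phi h.
apply: (adm_trim (phi := phi \o Fscal r)) => //; last exact: phi0 h.
have D t := @dom_scal W r t oW rW; case: h => h _; split; rewrite /Fscal /=.
- by move=> U m m' b d; apply: (pull_addm h); exact: D d.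
- move=> U m b b' d d'; rewrite -(pull_addb h); do ?[exact: D d|exact: D d'].
  by congr (phi (pull_mk _ _)); apply/funext => y; rewrite mulrDr.
- move=> U m b s d sU; rewrite (pull_bal h) //; last exact: D d.
  by congr (phi (pull_mk _ _)); apply/funext => y; rewrite mulrCA.
- by move=> U V m b d *; apply: (pull_res h) => //; exact: D d.
- move=> U m b b' d b'W bb; apply: (pull_ext h); first exact: D d.
    exact: reg_mul.
  by move=> y /bb ->.
Qed.

Let adm_lam g (W : set Y) : open W ->
  forall (A : zmodType) (phi : pull_gen -> A), pull_adm (aY g @^-1` W) phi ->
  pull_adm W (phi \o (Flam g \o trim W)).
Proof.
move=> oW A phi h.
apply: (adm_trim (phi := phi \o Flam g)) => //; last exact: Flam0 h.
have D t := @dom_lam g W t oW; case: h => h _; split;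
  rewrite /Flam /=.
- move=> U m m' b d; rewrite lamD; last by case: d.
  by apply: (pull_addm h); exact: D d.
- by move=> U m b b' d d'; apply: (pull_addb h); [exact: D d|exact: D d'].
- move=> U m b s d sU; have oU : open U by case: d.
  rewrite lam_scal // (pull_bal h) //; last exact: mreg.
    by congr (phi (pull_mk _ _)); apply/funext => y /=; rewrite hq.
  exact: D d.
- move=> U V m b d oV VU WV; have oU : open U by case: d.
  rewrite lam_res // (pull_res h) //; do ?[exact: D d|exact: mcont].
    by move=> x /VU.
  by move=> y /WV; rewrite /preimage /= hq.
- move=> U m b b' d b'W bb; apply: (pull_ext h); first exact: D d.
    exact: mreg.
  by move=> y /bb.
Qed.

Let pullP : eqmod_axioms pres pscal plam.
Proof.
have og g (W : set Y) : open W -> open (aY g @^-1` W) := @mcont _ _ _ (aY g) W.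
have zz (W : set Y) : trim W zg = zg by rewrite /trim; case: ifP.
have Ez W (A : zmodType) (phi : pull_gen -> A) t : pull_adm W phi ->
   (projT2 t).1 = 0 -> phi t = 0.
  by case: t => U [m b] /= h ->; exact: phi0 h.
have T0 (W : set Y) t : (projT2 t).1 = 0 -> (projT2 (trim W t)).1 = 0.
  by rewrite /trim; case: ifP.
have L0 g t : open (projT1 t) -> (projT2 t).1 = 0 -> (projT2 (Flam g t)).1 = 0.
  by move=> oU /= ->; exact: lam0.
have TO (W : set Y) t : open (projT1 t) -> open (projT1 (trim W t)).
  by rewrite /trim; case: ifP => // _ _; exact: openT.
have oz : open (projT1 zg) by exact: openT.
have oL g t : open (projT1 t) -> open (projT1 (Flam g t)).
  by move=> o; exact: mcont.
split; rewrite /psec /pres /pscal /plam.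
- by move=> U V oU oV VU m n; apply: gmapD; exact: adm_res oU oV VU.
- move=> U oU m; apply: genP => A phi h; rewrite gev_map //.
  apply: gev_ext => t /=; case: (pselect (pull_dom U t)) => d.
    by rewrite trimT.
  by rewrite !(trimF d) (proj2 h t d); exact: phi0 h.
- move=> U V W oU oV oW VU WV m; apply: genP => A phi h.
  rewrite !gev_map //; last exact: adm_res oV oW WV _ _ h.
  apply: gev_ext => t /=; case: (pselect (pull_dom U t)) => d.
    by rewrite !(trimT d) trimT //; exact: dom_res VU d.
  by rewrite !(trimF d) zz.
- by move=> U r oU rU m n; apply: gmapD; exact: adm_scal.
- move=> U r s oU rU sU m; apply: genP => A phi h.
  rewrite gevD // !gev_map // -gev_addf; apply: gev_ext => t /=.
  case: (pselect (pull_dom U t)) => d; last first.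
    by rewrite !(trimF d) !(Ez U) // addr0.
  rewrite trimT // /Fscal -(pull_addb (proj1 h)); do ?[exact: dom_scal d].
  by congr (phi (pull_mk _ _)); apply/funext => y; rewrite mulrDl.
- move=> U r s oU rU sU m; apply: genP => A phi h.
  rewrite !gev_map //; last exact: adm_scal.
  apply: gev_ext => t /=; case: (pselect (pull_dom U t)) => d; last first.
    by rewrite !(trimF d) !(Ez U) //; exact: T0.
  rewrite !(trimT d) trimT; last exact: dom_scal d.
  by congr (phi (pull_mk _ _)); apply/funext => y /=; rewrite mulrA.
- move=> U oU m; apply: genP => A phi h; rewrite gev_map //.
  apply: gev_ext => t /=; case: (pselect (pull_dom U t)) => d; last first.
    by rewrite !(trimF d) (proj2 h t d); exact: phi0 h.
  rewrite trimT //; case: t d => V [n b] d; congr (phi (pull_mk _ _)).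
  by apply/funext => y /=; rewrite mul1r.
- move=> U r s oU rU sU rs m; apply: genP => A phi h; rewrite !gev_map //.
  apply: gev_ext => t /=; case: (pselect (pull_dom U t)) => d; last first.
    by rewrite !(trimF d) !(Ez U).
  rewrite trimT //; apply: (pull_ext (proj1 h)); first exact: dom_scal d.
    by apply: reg_mul => //; case: d.
  by move=> y /rs /= ->.
- move=> U V r oU oV VU rU m; apply: genP => A phi h.
  have rV := reg_sub oU oV VU rU.
  have h1 := adm_res oU oV VU h; have h2 := adm_scal oV rV h.
  rewrite !gev_map //; apply: gev_ext => t /=.
  case: (pselect (pull_dom U t)) => d; last first.
    by rewrite !(trimF d) !(Ez V) //; exact: T0.
  rewrite !(trimT d) trimT; last exact: dom_scal d.
  by rewrite trimT //; exact: dom_res VU d.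
- by move=> g U oU m n; apply: gmapD; exact: adm_lam.
- move=> g U r oU rU m; apply: genP => A phi h.
  have oUg := og g _ oU; have rg := mreg (aY g) oU rU.
  have h1 := adm_lam oU h; have h2 := adm_scal oUg rg h.
  rewrite !gev_map //; apply: gev_ext => t /=.
  case: (pselect (pull_dom U t)) => d; last first.
    rewrite !(trimF d) !(Ez _ A phi _ h) //.
    + by apply: (T0); apply: L0.
    + by apply: (L0); [apply: (TO)|exact: T0].
  rewrite !(trimT d) trimT; last exact: dom_scal d.
  by rewrite trimT //; exact: dom_lam d.
- move=> g U V oU oV VU m; apply: genP => A phi h.
  have s : aY g @^-1` V `<=` aY g @^-1` U by move=> y /VU.
  have h1 := adm_lam oV h; have h2 := adm_res (og g _ oU) (og g _ oV) s h.
  rewrite !gev_map //; apply: gev_ext => t /=.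
  case: (pselect (pull_dom U t)) => d; last first.
    rewrite !(trimF d) !(Ez _ A phi _ h) //.
    + by apply: (T0); apply: L0.
    + by apply: (L0); [apply: (TO)|exact: T0].
  rewrite !(trimT d) trimT; last exact: dom_res VU d.
  by rewrite trimT //; exact: dom_lam d.
- move=> U oU m; apply: genP => A phi h; rewrite !gev_map //.
  apply: gev_ext => t /=.
  case: (pselect (pull_dom U t)) => d; last first.
    rewrite !(trimF d) !(Ez _ A phi _ h) //; exact: L0.
  rewrite trimT //; case: t d => V [n b] d.
  have oV : open V by case: d.
  rewrite /Flam /= lam1 // (pull_res (proj1 h)) //.
  + by congr (phi (pull_mk _ _)); apply/funext => y /=; rewrite act_fun1.
  + have -> : b \o aY 1%g = b by apply/funext => y /=; rewrite act_fun1.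
    by rewrite act1_preim.
  + exact: mcont.
  + by rewrite act1_preim.
  + by rewrite !act1_preim; case: d.
- move=> g h U oU m; apply: genP => A phi hphi.
  have s : aY (g * h)%g @^-1` U `<=` aY h @^-1` (aY g @^-1` U).
    by rewrite actM_preim.
  have o1 := og g _ oU; have o2 := og h _ o1; have o3 := og (g * h)%g _ oU.
  have h1 := adm_res o2 o3 s hphi; have h2 := adm_lam o1 h1.
  rewrite !gev_map //; apply: gev_ext => t /=.
  case: (pselect (pull_dom U t)) => d; last first.
    rewrite !(trimF d) !(Ez _ A phi _ hphi) //.
    + by apply: (T0); apply: (L0); [apply: (TO); apply: oL|apply: (T0); exact: L0].
    + exact: L0.
  have d1 := @dom_lam g U _ oU d; have d2 := @dom_lam h _ _ o1 d1.
  rewrite (trimT d) (trimT d1) (trimT d2).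
  case: t d d1 d2 => V [n b] d d1 d2; have oV : open V by case: d.
  have e : b \o aY (g * h)%g = (b \o aY g) \o aY h.
    by apply/funext => y /=; rewrite act_funM.
  rewrite /Flam /= lamM // e (pull_res (proj1 hphi)) //.
  + by rewrite actM_preim; exact: d2.
  + exact: mcont.
  + by rewrite actM_preim.
  + by case: d => /= _ UV _ y; rewrite /preimage /= -hq => /UV.
Qed.

(* W |-> colim_U O(W) (x)_{O(U)} M(U), over the open sets U containing q(W) *)
Definition pull_presheaf : eqmod aY := EqMod pullP.
End PullPresheaf.

Section Sheafification.
Variables (G : finGroupType) (X : kspace k) (a : gaction G X) (M : eqmod a).

Definition germ_eq (x : X) (U : set X) (m : M U) (V : set X) (n : M V) : Prop :=
  exists W : set X, [/\ open W, W x, W `<=` U, W `<=` V & res W m = res W n].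

Let lset := forall W : set X, M W -> Prop.

(* Local data on (the interior of) U: an open cover of U by sets W with
   sections of M over W having the same germs on overlaps. *)
Record local_data (U : set X) (S : lset) : Prop := {
  ld_open : forall W m, S W m -> open W /\ W `<=` U;
  ld_cover : forall x, (interior U) x -> exists (W : set X) m, W x /\ S W m;
  ld_compat : forall W m W' m' x, S W m -> S W' m' -> W x -> W' x ->
    germ_eq x m m' }.

(* A section of the associated sheaf is a maximal local datum, namely the set of
   all sections of M over open subsets of U which induce the given section. *)
Record shsec_axioms (U : set X) (S : lset) : Prop := {
  sh_local : local_data U S;
  sh_saturated : forall (W : set X) (m : M W), open W -> W `<=` U ->
    (forall x, W x -> exists (W' : set X) m',
      [/\ W' x, S W' m' & germ_eq x m m']) -> S W m }.

Definition shsec (U : set X) : Type := {S : lset | shsec_axioms U S}.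

Let sat (U : set X) (B : lset) : lset := fun W m =>
  [/\ open W, W `<=` U & forall x, W x -> exists (W' : set X) m',
    [/\ W' x, B W' m' & germ_eq x m m']].

Let geR (U : set X) (m : M U) x : open U -> U x -> germ_eq x m m.
Proof. by move=> oU Ux; exists U; split. Qed.
Let geS (U V : set X) (m : M U) (n : M V) x :
  germ_eq x m n -> germ_eq x n m.
Proof. by move=> [W [? ? ? ? e]]; exists W; split. Qed.
Let geT (U V W : set X) (m : M U) (n : M V) (p : M W) x :
  open U -> open V -> open W ->
  germ_eq x m n -> germ_eq x n p -> germ_eq x m p.
Proof.
move=> oU oV oW [A [oA Ax AU AV e]] [B [oB Bx BV BW e']].
have oI := openI oA oB; exists (A `&` B); split => //.
- by move=> y [/AU].
- by move=> y [_ /BW].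
- have := congr1 (@res _ _ _ _ A (A `&` B)) e.
  have := congr1 (@res _ _ _ _ B (A `&` B)) e'.
  by rewrite !res_comp // => <- <-.
Qed.
Let ge_res (U V : set X) (m : M U) x : open U -> open V -> V `<=` U -> V x ->
  germ_eq x (res V m) m.
Proof. by move=> oU oV VU Vx; exists V; split => //; rewrite res_id. Qed.

Let sat_sec (U : set X) (B : lset) : local_data U B -> shsec_axioms U (sat U B).
Proof.
move=> [h1 h2 h3]; split; first split.
- by move=> W m [].
- move=> x /h2 [W [m [Wx BWm]]]; exists W, m; split => //.
  have [oW WU] := h1 _ _ BWm; split => // y Wy; exists W, m; split => //.
  exact: geR.
- move=> W m W' m' x [oW _ h] [oW' _ h'] Wx Wx'.
  have [V [n [Vx Bn e]]] := h _ Wx; have [V' [n' [Vx' Bn' e']]] := h' _ Wx'.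
  have [oV _] := h1 _ _ Bn; have [oV' _] := h1 _ _ Bn'.
  apply: (geT oW oV oW' e); apply: (geT oV oV' oW' _ (geS e')).
  exact: h3 Bn Bn' Vx Vx'.
- move=> W m oW WU h; split => // x Wx.
  have [W' [m' [Wx' [oW' WU' h'] e]]] := h _ Wx.
  have [V [n [Vx Bn e']]] := h' _ Wx'; exists V, n; split => //.
  have [oV _] := h1 _ _ Bn; exact: geT e e'.
Qed.

Let zeroB (U : set X) : lset := fun W m => [/\ open W, W `<=` U & m = 0].
Let zero_ld (U : set X) : local_data U (zeroB U).
Proof.
split.
- by move=> W m [].
- move=> x Ux; exists (interior U), 0; split => //; split => //.
    exact: open_interior.
  exact: interior_subset.
- move=> W m W' m' x [oW _ ->] [oW' _ ->] Wx Wx'.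
  have oI := openI oW oW'; exists (W `&` W'); split => //.
  by rewrite !res0.
Qed.
Let mk (U : set X) (B : lset) : shsec U :=
  if pselect (local_data U B) is left h then exist _ _ (sat_sec h)
  else exist _ _ (sat_sec (zero_ld U)).

Let S_ (U : set X) (s : shsec U) : lset := proj1_sig s.

Let mk_in (U : set X) B (W : set X) (m : M W) :
  local_data U B -> B W m -> S_ (mk U B) m.
Proof.
rewrite /mk => h BWm; case: pselect => // h' /=.
have [oW WU] := ld_open h BWm; split => // x Wx; exists W, m; split => //.
exact: geR.
Qed.

Let s_open (U : set X) (s : shsec U) W (m : M W) : S_ s m -> open W.
Proof. by move=> /(ld_open (sh_local (proj2_sig s))) []. Qed.
Let s_sub (U : set X) (s : shsec U) W (m : M W) : S_ s m -> W `<=` U.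
Proof. by move=> /(ld_open (sh_local (proj2_sig s))) []. Qed.
Let s_int (U : set X) (s : shsec U) W (m : M W) x : S_ s m -> W x ->
  (interior U) x.
Proof.
move=> h Wx; have oW := s_open h; have WU := s_sub h.
by move: WU; rewrite (open_subsetE _ oW); apply.
Qed.
Let s_res (U : set X) (s : shsec U) (W V : set X) (m : M W) : S_ s m ->
  open V -> V `<=` W -> S_ s (res V m).
Proof.
move=> h oV VW; have oW := s_open h; have WU := s_sub h.
apply: (sh_saturated (proj2_sig s)) => //; first exact: subset_trans WU.
move=> x Vx; exists W, m; split => //; [exact: VW|exact: ge_res].
Qed.
Let s_cover (U : set X) (s : shsec U) x : (interior U) x ->
  exists (W : set X) m, W x /\ S_ s (W := W) m.
Proof. exact: (ld_cover (sh_local (proj2_sig s))). Qed.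
Let s_compat (U : set X) (s : shsec U) (W W' : set X) (m : M W) (m' : M W') x :
  S_ s m -> S_ s m' -> W x -> W' x -> germ_eq x m m'.
Proof. exact: (ld_compat (sh_local (proj2_sig s))). Qed.

Let s_ext (U : set X) (s t : shsec U) :
  (forall x, (interior U) x ->
    exists (W : set X) m, [/\ W x, S_ s (W := W) m & S_ t m]) -> s = t.
Proof.
move=> h; have sub (s' t' : shsec U) : (forall x, (interior U) x ->
    exists (W : set X) m, [/\ W x, S_ s' (W := W) m & S_ t' m]) ->
    forall W m, S_ s' (W := W) m -> S_ t' m.
  move=> h' W m Sm; apply: (sh_saturated (proj2_sig t')) => //.
  - exact: s_open Sm.
  - exact: s_sub Sm.
  move=> x Wx; have [V [n [Vx Sn Tn]]] := h' _ (s_int Sm Wx).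
  by exists V, n; split => //; exact: s_compat Sm Sn Wx Vx.
have : S_ s = S_ t.
  rewrite /S_; apply: functional_extensionality_dep => W.
  apply/funext => m; apply/propext; split; first exact: sub.
  by apply: sub => x /h [V [n [? ? ?]]]; exists V, n.
by case: s t {h sub} => [S hS] [T hT]; exact: eq_exist.
Qed.

(* common representatives *)
Let s_rep2 (U : set X) (s t : shsec U) x : (interior U) x ->
  exists (W : set X) m n,
    [/\ open W, W x, W `<=` U, S_ s (W := W) m & S_ t (W := W) n].
Proof.
move=> Ux; have [W [m [Wx Sm]]] := s_cover s Ux.
have [V [n [Vx Tn]]] := s_cover t Ux.
have oI := openI (s_open Sm) (s_open Tn).
exists (W `&` V), (res _ m), (res _ n); split => //.
- by move=> y [/(s_sub Sm)].
- by apply: s_res => //; exact: subIsetl.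
- by apply: s_res => //; exact: subIsetr.
Qed.
Let s_rep3 (U : set X) (s t u : shsec U) x : (interior U) x ->
  exists (W : set X) m n p,
    [/\ open W, W x, S_ s (W := W) m, S_ t (W := W) n & S_ u (W := W) p].
Proof.
move=> Ux; have [W [m [n [oW Wx _ Sm Tn]]]] := s_rep2 s t Ux.
have [V [p [Vx Up]]] := s_cover u Ux.
have oI := openI oW (s_open Up).
exists (W `&` V), (res _ m), (res _ n), (res _ p); split => //;
  by apply: s_res => //; do ?[exact: subIsetl|exact: subIsetr].
Qed.
Let s_mk (U : set X) B x : local_data U B -> (interior U) x ->
  exists (W : set X) m, W x /\ B W m.
Proof. by move=> h; exact: (ld_cover h). Qed.

Let s0 (U : set X) : shsec U := mk U (zeroB U).
Let addB (U : set X) (s t : shsec U) : lset := fun W m =>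
  exists m1 m2, [/\ S_ s (W := W) m1, S_ t (W := W) m2 & m = m1 + m2].
Let add_ld (U : set X) (s t : shsec U) : local_data U (addB s t).
Proof.
split.
- by move=> W m [m1 [m2 [h _ _]]]; split; [exact: s_open h|exact: s_sub h].
- move=> x /(s_rep2 s t) [W [m [n [_ Wx _ Sm Tn]]]].
  by exists W, (m + n); split => //; exists m, n.
- move=> W m W' m' x [m1 [m2 [h1 h2 ->]]] [n1 [n2 [g1 g2 ->]]] Wx Wx'.
  have [V [oV Vx VW VW' e]] := s_compat h1 g1 Wx Wx'.
  have [V' [oV' Vx' V'W V'W' e']] := s_compat h2 g2 Wx Wx'.
  have oI := openI oV oV'; have oW := s_open h1; have oW' := s_open g1.
  have i1 : V `&` V' `<=` V by exact: subIsetl.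
  have i2 : V `&` V' `<=` V' by exact: subIsetr.
  exists (V `&` V'); split => //.
  + exact: subset_trans i1 VW.
  + exact: subset_trans i1 VW'.
  + have j1 := congr1 (@res _ _ _ _ V (V `&` V')) e.
    have j2 := congr1 (@res _ _ _ _ V' (V `&` V')) e'.
    rewrite !res_comp // in j1 j2.
    rewrite !resD ?j1 ?j2 //; [exact: subset_trans i1 VW'|].
    exact: subset_trans i1 VW.
Qed.
Let oppB (U : set X) (s : shsec U) : lset := fun W m => S_ s (- m).
Let resN (U V : set X) (m : M U) : open U -> open V -> V `<=` U ->
  res V (- m) = - res V m.
Proof.
move=> oU oV VU; apply: (@addrI _ (res V m)).
by rewrite -resD // !subrr res0.
Qed.
Let opp_ld (U : set X) (s : shsec U) : local_data U (oppB s).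
Proof.
split.
- by move=> W m h; split; [exact: s_open h|exact: s_sub h].
- move=> x /(s_cover s) [W [m [Wx h]]]; exists W, (- m).
  by split => //; rewrite /oppB opprK.
- move=> W m W' m' x h h' Wx Wx'.
  have [V [oV Vx VW VW' e]] := s_compat h h' Wx Wx'.
  exists V; split => //; apply: oppr_inj.
  by rewrite -!resN //; [exact: s_open h'|exact: s_open h].
Qed.

Let sadd (U : set X) (s t : shsec U) := mk U (addB s t).
Let sopp (U : set X) (s : shsec U) := mk U (oppB s).
Let sadd_in (U : set X) (s t : shsec U) (W : set X) (m n : M W) :
  S_ s m -> S_ t n -> S_ (sadd s t) (m + n).
Proof. by move=> h h'; apply: mk_in; [exact: add_ld|exists m, n]. Qed.
Let sopp_in (U : set X) (s : shsec U) (W : set X) (m : M W) :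
  S_ s m -> S_ (sopp s) (- m).
Proof. by move=> h; apply: mk_in; [exact: opp_ld|rewrite /oppB opprK]. Qed.
Let s0_in (U W : set X) : open W -> W `<=` U -> S_ (s0 U) (0 : M W).
Proof. by move=> *; apply: mk_in; [exact: zero_ld|split]. Qed.

Let saddA (U : set X) : associative (@sadd U).
Proof.
move=> s t u; apply: s_ext => x /(s_rep3 s t u) [W [m [n [p [oW Wx h1 h2 h3]]]]].
exists W, (m + (n + p)); split => //; first by do ?[apply: sadd_in].
by rewrite addrA; do ?[apply: sadd_in].
Qed.
Let saddC (U : set X) : commutative (@sadd U).
Proof.
move=> s t; apply: s_ext => x /(s_rep2 s t) [W [m [n [oW Wx _ h1 h2]]]].
exists W, (m + n); split => //; first exact: sadd_in.
by rewrite addrC; exact: sadd_in.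
Qed.
Let sadd0 (U : set X) : left_id (s0 U) (@sadd U).
Proof.
move=> s; apply: s_ext => x /(s_cover s) [W [m [Wx h]]].
exists W, m; split => //; rewrite -[m]add0r; apply: sadd_in => //.
by apply: s0_in; [exact: s_open h|exact: s_sub h].
Qed.
Let saddN (U : set X) : left_inverse (s0 U) (@sopp U) (@sadd U).
Proof.
move=> s; apply: s_ext => x /(s_cover s) [W [m [Wx h]]].
exists W, 0; split => //; last first.
  by apply: s0_in; [exact: s_open h|exact: s_sub h].
by rewrite -(addNr m); apply: sadd_in => //; exact: sopp_in.
Qed.

HB.instance Definition _ (U : set X) := gen_eqMixin (shsec U).
HB.instance Definition _ (U : set X) := gen_choiceMixin (shsec U).
HB.instance Definition _ (U : set X) :=
  GRing.isZmodule.Build (shsec U) (@saddA U) (@saddC U) (@sadd0 U) (@saddN U).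

Let sD (U : set X) (s t : shsec U) (W : set X) (m n : M W) :
  S_ s m -> S_ t n -> S_ (s + t) (m + n).
Proof. exact: sadd_in. Qed.

Let resB (U V : set X) (s : shsec U) : lset := fun W m => S_ s m /\ W `<=` V.
Let res_ld (U V : set X) (s : shsec U) : V `<=` U -> local_data V (resB V s).
Proof.
move=> VU; split.
- by move=> W m [h WV]; split => //; exact: s_open h.
- move=> x Vx; have [W [m [Wx h]]] := s_cover s (interiorS VU Vx).
  have oI := openI (s_open h) (@open_interior _ V).
  exists (W `&` interior V), (res _ m); split => //; split.
    by apply: s_res => //; exact: subIsetl.
  by move=> y [_ /interior_subset].
- by move=> W m W' m' x [h _] [h' _]; exact: (s_compat h h').
Qed.
Let sres (U V : set X) (s : shsec U) : shsec V := mk V (resB V s).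
Let sres_in (U V : set X) (s : shsec U) (W : set X) (m : M W) :
  V `<=` U -> W `<=` V -> S_ s m -> S_ (sres V s) m.
Proof. by move=> VU WV h; apply: mk_in; [exact: res_ld|]. Qed.

Let scalB (U : set X) r (s : shsec U) : lset := fun W m =>
  exists2 n, S_ s (W := W) n & m = scal r n.
Let scal_ld (U : set X) r (s : shsec U) : open U -> reg U r ->
  local_data U (scalB r s).
Proof.
move=> oU rU; split.
- by move=> W m [n h _]; split; [exact: s_open h|exact: s_sub h].
- move=> x /(s_cover s) [W [m [Wx h]]]; exists W, (scal r m).
  by split => //; exists m.
- move=> W m W' m' x [n h ->] [n' h' ->] Wx Wx'.
  have [V [oV Vx VW VW' e]] := s_compat h h' Wx Wx'.
  have oW := s_open h; have oW' := s_open h'.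
  exists V; split => //; rewrite !res_scal ?e //.
    exact: (reg_sub oU oW' (s_sub h')).
  exact: (reg_sub oU oW (s_sub h)).
Qed.
Let sscal (U : set X) r (s : shsec U) : shsec U := mk U (scalB r s).
Let sscal_in (U : set X) r (s : shsec U) (W : set X) (m : M W) :
  open U -> reg U r -> S_ s m -> S_ (sscal r s) (scal r m).
Proof. by move=> oU rU h; apply: mk_in; [exact: scal_ld|exists m]. Qed.

Let intE (U : set X) : open U -> interior U = U.
Proof. by move=> oU; apply/interior_id. Qed.
Let og g (U : set X) : open U -> open (a g @^-1` U).
Proof. exact: mcont. Qed.

Let lamB g (U : set X) (s : shsec U) : lset := fun W m =>
  exists (V : set X) (n : M V),
    [/\ S_ s n, W = a g @^-1` V & m = res W (lam g n)].
Let lam_ld g (U : set X) (s : shsec U) : open U ->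
  local_data (a g @^-1` U) (lamB g s).
Proof.
move=> oU; split.
- move=> W m [V [n [h e _]]]; rewrite e; split.
    by apply: og; exact: s_open h.
  by move=> y /(s_sub h).
- move=> x; rewrite (intE (og g oU)) => Ux.
  have Ux' : (interior U) (a g x) by rewrite intE.
  have [W [m [Wx h]]] := s_cover s Ux'.
  by exists (a g @^-1` W), (res _ (lam g m)); split => //; exists W, m.
- move=> W m W' m' x [V [n [h eW em]]] [V' [n' [h' eW' em']]] Vx Vx'.
  subst W W' m m'.
  have [A [oA Ax AV AV' e]] := s_compat h h' Vx Vx'.
  have oV := s_open h; have oV' := s_open h'.
  have j1 : a g @^-1` A `<=` a g @^-1` V by move=> y /AV.
  have j2 : a g @^-1` A `<=` a g @^-1` V' by move=> y /AV'.
  exists (a g @^-1` A); split => //; first exact: og.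
  by rewrite !res_comp //; do ?[exact: og]; rewrite -!lam_res // e.
Qed.
Let slam g (U : set X) (s : shsec U) : shsec (a g @^-1` U) :=
  mk (a g @^-1` U) (lamB g s).
Let slam_in g (U : set X) (s : shsec U) (W : set X) (m : M W) :
  open U -> S_ s m -> S_ (slam g s) (lam g m).
Proof.
move=> oU h; apply: mk_in; first exact: lam_ld.
by exists W, m; split => //; rewrite res_id //; apply: og; exact: s_open h.
Qed.

Let shP : eqmod_axioms (sec := fun U => shsec U) sres sscal slam.
Proof.
split.
- move=> U V oU oV VU s t; apply: s_ext => x Vx.
  have [W [m [n [oW Wx _ h1 h2]]]] := s_rep2 s t (interiorS VU Vx).
  have oI := openI oW oV; have Vx' := interior_subset Vx.
  exists (W `&` V), (res _ (m + n)); split => //.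
    apply: sres_in => //.
    by apply: s_res => //; exact: sD.
  rewrite resD //.
  by apply: sD; apply: sres_in => //; exact: s_res.
- move=> U oU s; apply: s_ext => x /(s_cover s) [W [m [Wx h]]].
  by exists W, m; split => //; apply: sres_in => //; exact: s_sub h.
- move=> U V W oU oV oW VU WV s; apply: s_ext => x Wx.
  have [A [m [Ax h]]] := s_cover s (interiorS (subset_trans WV VU) Wx).
  have oI := openI (s_open h) oW; have Wx' := interior_subset Wx.
  have h' : S_ s (res (A `&` W) m) by exact: s_res.
  exists (A `&` W), (res _ m); split => //.
    apply: sres_in => //.
    by apply: sres_in => // y [_ /WV].
  by apply: sres_in => //; exact: subset_trans VU.
- move=> U r oU rU s t; apply: s_ext => x /(s_rep2 s t).
  move=> [W [m [n [oW Wx WU h1 h2]]]]; exists W, (scal r (m + n)); split => //.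
    by apply: sscal_in => //; exact: sD.
  rewrite scalDr //; first by apply: sD; exact: sscal_in.
  exact: (reg_sub oU oW WU).
- move=> U r s oU rU sU t; apply: s_ext => x /(s_cover t) [W [m [Wx h]]].
  exists W, (scal (fun x => r x + s x) m); split => //.
    by apply: sscal_in => //; exact: reg_add.
  have oW := s_open h; have WU := s_sub h.
  rewrite scalDl //; first by apply: sD; exact: sscal_in.
    exact: (reg_sub oU oW WU rU).
  exact: (reg_sub oU oW WU sU).
- move=> U r s oU rU sU t; apply: s_ext => x /(s_cover t) [W [m [Wx h]]].
  exists W, (scal (fun x => r x * s x) m); split => //.
    by apply: sscal_in => //; exact: reg_mul.
  have oW := s_open h; have WU := s_sub h.
  rewrite scalM //; first by apply: sscal_in => //; exact: sscal_in.
    exact: (reg_sub oU oW WU rU).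
  exact: (reg_sub oU oW WU sU).
- move=> U oU t; apply: s_ext => x /(s_cover t) [W [m [Wx h]]].
  exists W, m; split => //; have oW := s_open h.
  by rewrite -[m]scal1 //; apply: sscal_in => //; exact: reg_cst.
- move=> U r s oU rU sU rs t; apply: s_ext => x /(s_cover t) [W [m [Wx h]]].
  have oW := s_open h; have WU := s_sub h.
  exists W, (scal r m); split => //; first exact: sscal_in.
  rewrite (@scal_ext _ _ _ M W r s m) //; first exact: sscal_in.
  + exact: (reg_sub oU oW WU rU).
  + exact: (reg_sub oU oW WU sU).
  + by move=> y /WU /rs.
- move=> U V r oU oV VU rU s; apply: s_ext => x Vx.
  have [W [m [Wx h]]] := s_cover s (interiorS VU Vx).
  have oW := s_open h; have WU := s_sub h.
  have oI := openI oW oV; have Vx' := interior_subset Vx.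
  exists (W `&` V), (res _ (scal r m)); split => //.
    apply: sres_in => //.
    by apply: s_res => //; exact: sscal_in.
  rewrite res_scal //; last exact: (reg_sub oU oW WU rU).
  apply: sscal_in => //; first exact: (reg_sub oU oV VU rU).
  by apply: sres_in => //; exact: s_res.
- move=> g U oU s t; apply: s_ext => x; rewrite (intE (og g oU)) => Ux.
  have Ux' : (interior U) (a g x) by rewrite intE.
  have [W [m [n [oW Wx WU h1 h2]]]] := s_rep2 s t Ux'.
  exists (a g @^-1` W), (lam g (m + n)); split => //.
    by apply: slam_in => //; exact: sD.
  by rewrite lamD //; apply: sD; exact: slam_in.
- move=> g U r oU rU s; apply: s_ext => x; rewrite (intE (og g oU)) => Ux.
  have Ux' : (interior U) (a g x) by rewrite intE.
  have [W [m [Wx h]]] := s_cover s Ux'.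
  have oW := s_open h; have WU := s_sub h.
  exists (a g @^-1` W), (lam g (scal r m)); split => //.
    by apply: slam_in => //; exact: sscal_in.
  rewrite lam_scal //; last exact: (reg_sub oU oW WU rU).
  by apply: sscal_in; [exact: og|exact: mreg|exact: slam_in].
- move=> g U V oU oV VU s; apply: s_ext => x; rewrite (intE (og g oV)) => Vx.
  have Ux' : (interior U) (a g x) by rewrite intE //; exact: VU.
  have [W [m [Wx h]]] := s_cover s Ux'.
  have oW := s_open h; have WU := s_sub h; have oI := openI oW oV.
  have iW : W `&` V `<=` W by exact: subIsetl.
  exists (a g @^-1` (W `&` V)), (lam g (res _ m)); split => //.
    apply: slam_in => //; apply: sres_in => //.
    exact: s_res.
  apply: sres_in; first by move=> y /VU.
    by move=> y [].
  by apply: slam_in => //; exact: s_res.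
- move=> U oU s; apply: s_ext => x; rewrite (intE (og 1%g oU)) => Ux.
  have Ux' : (interior U) (a 1%g x) by rewrite intE.
  have [W [m [Wx h]]] := s_cover s Ux'.
  have oW := s_open h; have WU := s_sub h.
  exists (a 1%g @^-1` W), (lam 1%g m); split => //; first exact: slam_in.
  rewrite lam1 //; apply: sres_in => //.
  + by rewrite act1_preim.
  + by move=> y /WU.
  + by apply: s_res => //; [exact: og|rewrite act1_preim].
- move=> g h U oU s; apply: s_ext => x; rewrite (intE (og _ oU)) => Ux.
  have Ux' : (interior U) (a (g * h)%g x) by rewrite intE.
  have [W [m [Wx hm]]] := s_cover s Ux'.
  have oW := s_open hm; have WU := s_sub hm.
  exists (a (g * h)%g @^-1` W), (lam (g * h)%g m); split => //.
    exact: slam_in.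
  rewrite lamM //; apply: sres_in => //.
  + by rewrite actM_preim.
  + by move=> y /WU.
  + apply: s_res; [|exact: og|by rewrite actM_preim].
    by apply: slam_in; [exact: og|exact: slam_in].
Qed.

Definition sheafify : eqmod a := EqMod shP.
End Sheafification.

Definition tensor (G : finGroupType) (X : kspace k) (a : gaction G X)
  (M N : eqmod a) : eqmod a := sheafify (tensor_presheaf M N).

Definition inverse_image (G : finGroupType) (Y X : kspace k) (aY : gaction G Y)
    (aX : gaction G X) (q : smorphism Y X) (hq : equivariant aY aX q)
    (M : eqmod aX) : eqmod aY :=
  sheafify (pull_presheaf hq M).
End Modules.

(* Main.v *)
(* Write q : Y1 -> Y2 for the projection.  The maps m (x) n |-> q^*m (x) n form
   an equivariant morphism from the presheaf tensor product of V and q_*F to the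
   direct image of that of q^*V and F.  Over an open set where V has a frame
   e_1, ..., e_n, both presheaves are identified with (q_*F)^n by coordinates
   along the e_i, so that, F being a sheaf, the morphism is locally bijective.
   A locally bijective morphism induces an isomorphism on associated
   sheaves. *)

Require Import Defs.
From mathcomp Require Import all_boot all_algebra all_fingroup.
From mathcomp Require Import boolp classical_sets topology.

Set Implicit Arguments.
Unset Strict Implicit.
Unset Printing Implicit Defensive.

Import GRing.Theory.
Local Open Scope classical_set_scope.
Local Open Scope ring_scope.

Section FormalSums.
Variables (T : Type) (adm : forall A : zmodType, (T -> A) -> Prop).

Definition gbase (t : T) : gen_group T adm := gcl adm [:: (false, t)].

Lemma gev_base (A : zmodType) (phi : T -> A) t :
  adm phi -> gev phi (gbase t) = phi t.
Proof. by move=> h; rewrite gev_cl // /fsum big_seq1. Qed.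

Lemma gev0 (A : zmodType) (phi : T -> A) :
  adm phi -> gev phi (0 : gen_group T adm) = 0.
Proof.
move=> h; apply: (@addrI _ (gev phi (0 : gen_group T adm))).
by rewrite -gevD // !addr0.
Qed.

Lemma gevN (A : zmodType) (phi : T -> A) (c : gen_group T adm) :
  adm phi -> gev phi (- c) = - gev phi c.
Proof.
by move=> h; apply: (@addrI _ (gev phi c)); rewrite -gevD // !subrr gev0.
Qed.

Lemma gev_sum (A : zmodType) (phi : T -> A) (I : Type) (r : seq I)
    (F : I -> gen_group T adm) :
  adm phi -> gev phi (\sum_(i <- r) F i) = \sum_(i <- r) gev phi (F i).
Proof.
move=> h; elim: r => [|i r IH]; first by rewrite !big_nil gev0.
by rewrite !big_cons gevD // IH.
Qed.

Lemma gen_ind (P : gen_group T adm -> Prop) :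
  (forall t, P (gbase t)) -> P 0 -> (forall c, P c -> P (- c)) ->
  (forall c d, P c -> P d -> P (c + d)) -> forall c, P c.
Proof.
move=> Pb P0 PN PD c.
have -> : c = \sum_(x <- grepr c) (if x.1 then - gbase x.2 else gbase x.2).
  apply: genP => A phi h; rewrite gev_sum //; apply: eq_bigr => -[[] t] _ /=.
    by rewrite gevN // gev_base.
  by rewrite gev_base.
elim: (grepr c) => [|[b t] s IH]; first by rewrite big_nil.
by rewrite big_cons; apply: PD => //; case: b => /=; [apply: PN|]; exact: Pb.
Qed.
End FormalSums.
Arguments gbase {T} adm t.

Lemma gmap_base (T T' : Type) (adm : forall A : zmodType, (T -> A) -> Prop)
    (adm' : forall A : zmodType, (T' -> A) -> Prop) (h : T -> T') t :
  (forall (A : zmodType) (phi : T' -> A), adm' A phi -> adm A (phi \o h)) ->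
  gmap adm' h (gbase adm t) = gbase adm' (h t).
Proof.
by move=> H; apply: genP => A phi hp; rewrite gev_map // !gev_base //; exact: H.
Qed.

Section AdditiveMaps.
Variables (A B : zmodType) (f : A -> B).
Hypothesis fD : {morph f : x y / x + y}.
Lemma add_map0 : f 0 = 0.
Proof. by apply: (@addrI _ (f 0)); rewrite -fD !addr0. Qed.
Lemma add_mapN : {morph f : x / - x}.
Proof. by move=> x; apply: (@addrI _ (f x)); rewrite -fD !subrr add_map0. Qed.
Lemma add_map_sum (I : Type) (r : seq I) (F : I -> A) :
  f (\sum_(i <- r) F i) = \sum_(i <- r) f (F i).
Proof.
elim: r => [|i r IH]; first by rewrite !big_nil add_map0.
by rewrite !big_cons fD IH.
Qed.
End AdditiveMaps.

Section SheafifyTheory.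
Variables (k : closedFieldType) (G : finGroupType) (X : kspace k)
  (a : gaction G X) (M : eqmod a).

Definition induces (U : set X) (s : sheafify M U) (W : set X) (m : M W) :
  Prop :=
  proj1_sig s W m.

Lemma germ_refl (U : set X) (m : M U) x : open U -> U x -> germ_eq x m m.
Proof. by move=> oU Ux; exists U; split. Qed.

Lemma germ_sym (U V : set X) (m : M U) (n : M V) x :
  germ_eq x m n -> germ_eq x n m.
Proof. by move=> [W [? ? ? ? e]]; exists W; split. Qed.

Lemma germ_res (U V : set X) (m : M U) x : open U -> open V -> V `<=` U ->
  V x -> germ_eq x (res V m) m.
Proof. by move=> oU oV VU Vx; exists V; split => //; rewrite res_id. Qed.

(* The lemmas [Defs.*_subproof] are the [Let] facts proved inside the sections
   of Defs.v, which survive their sections as constants with these names. *)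
Lemma germ_trans (U V W : set X) (m : M U) (n : M V) (p : M W) x :
  open U -> open V -> open W ->
  germ_eq x m n -> germ_eq x n p -> germ_eq x m p.
Proof. exact: Defs.geT_subproof. Qed.

Variable (U : set X).
Implicit Types (s t : sheafify M U) (V W : set X).

Lemma induces_open s W (m : M W) : induces s m -> open W.
Proof. by move=> /(ld_open (sh_local (proj2_sig s))) []. Qed.

Lemma induces_subset s W (m : M W) : induces s m -> W `<=` U.
Proof. by move=> /(ld_open (sh_local (proj2_sig s))) []. Qed.

Lemma induces_cover s x : open U -> U x ->
  exists W (m : M W), W x /\ induces s m.
Proof.
move=> /interior_id e Ux; apply: (ld_cover (sh_local (proj2_sig s))).
by rewrite e.
Qed.

Lemma induces_germ s W (m : M W) W' (m' : M W') x :
  induces s m -> induces s m' -> W x -> W' x -> germ_eq x m m'.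
Proof. exact: (ld_compat (sh_local (proj2_sig s))). Qed.

Lemma induces_saturated s W (m : M W) : open W -> W `<=` U ->
  (forall x, W x -> exists W' (m' : M W'),
     [/\ W' x, induces s m' & germ_eq x m m']) -> induces s m.
Proof. exact: (sh_saturated (proj2_sig s)). Qed.

Lemma induces_restrict s W (m : M W) V :
  induces s m -> open V -> V `<=` W -> induces s (res V m).
Proof.
move=> h oV VW; have oW := induces_open h.
apply: induces_saturated => //.
  by apply: subset_trans VW _; exact: induces_subset h.
by move=> x Vx; exists W, m; split => //; [exact: VW|exact: germ_res].
Qed.

Lemma shsec_ext s t : open U ->
  (forall x, U x -> exists W (m : M W), [/\ W x, induces s m & induces t m]) ->
  s = t.
Proof.
move=> /interior_id e h; apply: Defs.s_ext_subproof => x; rewrite e; exact: h.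
Qed.

Lemma induces_common s t x : open U -> U x ->
  exists W (m n : M W), [/\ W x, induces s m & induces t n].
Proof.
move=> oU Ux; have [W [m [Wx hm]]] := induces_cover s oU Ux.
have [V [n [Vx hn]]] := induces_cover t oU Ux.
have oI := openI (induces_open hm) (induces_open hn).
exists (W `&` V), (res _ m), (res _ n); split => //.
  by apply: induces_restrict => //; exact: subIsetl.
by apply: induces_restrict => //; exact: subIsetr.
Qed.

Lemma inducesD s t W (m n : M W) :
  induces s m -> induces t n -> induces (s + t) (m + n).
Proof. exact: Defs.sadd_in_subproof. Qed.

Lemma induces0 W : open W -> W `<=` U -> induces (0 : sheafify M U) (0 : M W).
Proof. exact: Defs.s0_in_subproof. Qed.

Lemma induces_res s V W (m : M W) : V `<=` U -> W `<=` V ->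
  induces s m -> induces (res V s) m.
Proof. exact: Defs.sres_in_subproof. Qed.

Lemma induces_scal r s W (m : M W) : open U -> reg U r ->
  induces s m -> induces (scal r s) (scal r m).
Proof. exact: Defs.sscal_in_subproof. Qed.

Lemma induces_lam g s W (m : M W) : open U ->
  induces s m -> induces (lam g s) (lam g m).
Proof. exact: Defs.slam_in_subproof. Qed.

Definition glue (B : forall W, M W -> Prop) : sheafify M U :=
  if pselect (local_data U B) is left h
  then exist _ _ (Defs.sat_sec_subproof h) else 0.

Lemma glue_in (B : forall W, M W -> Prop) W (m : M W) :
  local_data U B -> B W m -> induces (glue B) m.
Proof.
rewrite /glue => h BWm; case: pselect => // h'.
have [oW WU] := ld_open h BWm; split => // x Wx; exists W, m; split => //.
exact: germ_refl.
Qed.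

Lemma glue_out (B : forall W, M W -> Prop) W (m : M W) :
  local_data U B -> induces (glue B) m ->
  forall x, W x -> exists W' (m' : M W'), [/\ W' x, B W' m' & germ_eq x m m'].
Proof. by rewrite /glue => h; case: pselect => // h' []. Qed.
End SheafifyTheory.

Section Homs.
Variables (k : closedFieldType) (G : finGroupType) (X : kspace k)
  (a : gaction G X).

Record eqmod_hom (M N : eqmod a) (f : forall U : set X, M U -> N U) : Prop := {
  homD : forall U, open U -> {morph f U : m n / m + n};
  hom_scal : forall U r m, open U -> reg U r -> f U (scal r m) = scal r (f U m);
  hom_res : forall U V m, open U -> open V -> V `<=` U ->
    f V (res V m) = res V (f U m);
  hom_lam : forall U g m, open U -> f _ (lam g m) = lam g (f U m) }.
End Homs.

Section PushSheafify.
Variables (k : closedFieldType) (G : finGroupType) (Y X : kspace k)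
  (aY : gaction G Y) (aX : gaction G X) (q : smorphism Y X)
  (hq : equivariant aY aX q) (M : eqmod aX) (N : eqmod aY)
  (f : forall U : set X, M U -> N (q @^-1` U)).
Hypothesis f_hom : @eqmod_hom _ _ _ _ M (direct_image hq N) f.
Hypothesis f_inj : forall x : X, exists U0 : set X, [/\ open U0, U0 x &
  forall W, open W -> W `<=` U0 -> forall m n : M W,
    (forall y, W (q y) -> germ_eq y (f m) (f n)) -> m = n].
Hypothesis f_surj : forall (U : set X) (s : sheafify N (q @^-1` U)) x,
  open U -> U x -> exists (W : set X) (m : M W),
    [/\ open W, W x, W `<=` U & induces s (f m)].

Let pull_sec (U : set X) (s : sheafify N (q @^-1` U)) (W : set X) (m : M W) :
  Prop := [/\ open W, W `<=` U & induces s (f m)].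

Let f_res (U V : set X) (m : M U) : open U -> open V -> V `<=` U ->
  f (res V m) = res (q @^-1` V) (f m).
Proof. exact: (hom_res f_hom). Qed.

Let germ_f (U V : set X) (m : M U) (n : M V) y : open U -> open V ->
  germ_eq (q y) m n -> germ_eq y (f m) (f n).
Proof.
move=> oU oV [W [oW Wy WU WV e]]; exists (q @^-1` W); split => //.
- exact: mcont.
- by move=> z /WU.
- by move=> z /WV.
- by rewrite -!f_res // e.
Qed.

Let pull_ld (U : set X) (s : sheafify N (q @^-1` U)) : open U ->
  local_data U (pull_sec s).
Proof.
move=> oU; split; first by move=> W m [].
  move=> x; rewrite (_ : interior U = U); last exact/interior_id.
  move=> /(f_surj s oU) [W [m [oW Wx WU h]]].
  by exists W, m.
move=> W m W' m' x [oW WU h] [oW' WU' h'] Wx Wx'.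
have [U0 [oU0 U0x inj]] := f_inj x.
have oI := openI oW oW'; have oA := openI oU0 oI.
have AW : U0 `&` (W `&` W') `<=` W by move=> z [_ []].
have AW' : U0 `&` (W `&` W') `<=` W' by move=> z [_ []].
exists (U0 `&` (W `&` W')); split => //; apply: inj => //.
move=> y Ay.
have Wy : W (q y) by exact: AW.
have Wy' : W' (q y) by exact: AW'.
have o V : open V -> open (q @^-1` V) := @mcont _ _ _ q V.
apply: (germ_trans (o _ oA) (o _ oW) (o _ oA)).
  by apply: germ_f => //; exact: germ_res.
apply: (germ_trans (o _ oW) (o _ oW') (o _ oA) (induces_germ h h' Wy Wy')).
by apply: germ_f => //; apply: germ_sym; exact: germ_res.
Qed.

Let psi (U : set X) (s : sheafify N (q @^-1` U)) : sheafify M U :=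
  glue U (pull_sec s).

Let psi_in (U : set X) (s : sheafify N (q @^-1` U)) (W : set X) (m : M W) :
  open U -> open W -> W `<=` U -> induces s (f m) -> induces (psi s) m.
Proof. by move=> oU oW WU h; apply: glue_in; [exact: pull_ld|]. Qed.

Let psi_out (U : set X) (s : sheafify N (q @^-1` U)) (W : set X) (m : M W) :
  open U -> induces (psi s) m -> induces s (f m).
Proof.
move=> oU h; have oW := induces_open h; have WU := induces_subset h.
apply: induces_saturated.
- exact: mcont.
- by move=> y /WU.
- move=> y Wy.
  have [W' [m' [Wy' [oW' WU' h'] e]]] := glue_out (pull_ld s oU) h Wy.
  by exists (q @^-1` W'), (f m'); split => //; exact: germ_f.
Qed.

Let psi_eq (U : set X) (s : sheafify N (q @^-1` U)) (t : sheafify M U) :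
  open U -> (forall x, U x -> exists (W : set X) (m : M W),
    [/\ W x, induces (psi s) m & induces t m]) -> psi s = t.
Proof. by move=> oU h; exact: shsec_ext. Qed.

Lemma direct_image_sheafify :
  eqmod_iso (direct_image hq (sheafify N)) (sheafify M).
Proof.
exists psi => U oU; have oqU := mcont q oU; split; first split.
- move=> s t; apply: psi_eq => // x Ux.
  have [W [m [n [Wx hm hn]]]] := induces_common (psi s) (psi t) oU Ux.
  exists W, (m + n); split => //; last exact: inducesD.
  apply: psi_in => //; [exact: induces_open hm|exact: induces_subset hm|].
  rewrite (homD f_hom); last exact: induces_open hm.
  by apply: inducesD; exact: psi_out.
- move=> r s rU; apply: psi_eq => // x Ux.
  have [W [m [Wx hm]]] := induces_cover (psi s) oU Ux.
  have oW := induces_open hm; have WU := induces_subset hm.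
  exists W, (scal r m); split => //; last exact: induces_scal.
  apply: psi_in => //.
  rewrite (hom_scal f_hom) //; last exact: reg_sub rU.
  by apply: induces_scal => //; [exact: mreg|exact: psi_out].
- move=> V s oV VU; apply: psi_eq => // x Vx.
  have [W [m [Wx hm]]] := induces_cover (psi s) oU (VU _ Vx).
  have oW := induces_open hm; have WU := induces_subset hm.
  have oI := openI oW oV; have iV : W `&` V `<=` V by exact: subIsetr.
  have iW : W `&` V `<=` W by exact: subIsetl.
  have hI := induces_restrict hm oI iW.
  exists (W `&` V), (res _ m); split => //; last exact: induces_res.
  apply: psi_in => //; apply: induces_res; last exact: psi_out hI.
    by move=> y /VU.
  by move=> y /iV.
- move=> g s; have oV := mcont (aX g) oU.
  apply: psi_eq => // x Ux.
  have [W [m [Wx hm]]] := induces_cover (psi s) oU Ux.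
  have oW := induces_open hm; have WU := induces_subset hm.
  exists (aX g @^-1` W), (lam g m); split => //; last exact: induces_lam.
  have oW' := mcont (aX g) oW.
  apply: psi_in => //; first by move=> y /WU.
  rewrite (hom_lam f_hom) //=; apply: induces_res.
  + by rewrite (equi_preim hq).
  + by move=> y /WU.
  + apply: induces_restrict; [|exact: mcont|by rewrite (equi_preim hq)].
    by apply: induces_lam => //; exact: psi_out.
- have psi_inj (s t : sheafify N (q @^-1` U)) : psi s = psi t -> s = t.
    move=> e; apply: shsec_ext => // y Uy.
    have [W [m [Wy hm]]] := induces_cover (psi s) oU Uy.
    exists (q @^-1` W), (f m); split => //; first exact: psi_out.
    by apply: psi_out => //; rewrite -e.
  have psi_surj (t : sheafify M U) :
      exists s : sheafify N (q @^-1` U), psi s = t.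
    pose B (W' : set Y) (m' : N W') := exists (W : set X) (m : M W),
      [/\ induces t m, W' = q @^-1` W & m' = res W' (f m)].
    have fin (W : set X) (m : M W) : induces t m -> B _ (f m).
      move=> h; exists W, m; split => //; rewrite res_id //.
      by apply: mcont; exact: induces_open h.
    have hB : local_data (q @^-1` U) B.
      split.
      + move=> W' m' [W [m [h eW _]]]; rewrite eW; split.
          by apply: mcont; exact: induces_open h.
        by move=> y; exact: (induces_subset h).
      + move=> y; rewrite (_ : interior _ = q @^-1` U); last exact/interior_id.
        move=> Uy; have [W [m [Wy hm]]] := induces_cover t oU Uy.
        by exists (q @^-1` W), (f m); split => //; exact: fin.
      + move=> W' m' V' n' y [W [m [h eW ->]]] [V [n [h' eV ->]]].
        subst W' V'; move=> Wy Vy.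
        have oW := induces_open h; have oV := induces_open h'.
        rewrite !res_id //; do ?exact: mcont.
        by apply: germ_f => //; exact: induces_germ h h' Wy Vy.
    exists (glue _ B); apply: psi_eq => // x Ux.
    have [W [m [Wx hm]]] := induces_cover t oU Ux.
    exists W, m; split => //; apply: psi_in => //.
    + exact: induces_open hm.
    + exact: induces_subset hm.
    + by apply: glue_in => //; exact: fin.
  pose inv t := projT1 (cid (psi_surj t)).
  have invK t : psi (inv t) = t by rewrite /inv; case: cid.
  exists inv => // s; exact/psi_inj/invK.
Qed.
End PushSheafify.

Section EqmodSums.
Variables (k : closedFieldType) (G : finGroupType) (X : kspace k)
  (a : gaction G X) (M : eqmod a).

Lemma res_sum (U W : set X) (I : Type) (r : seq I) (F : I -> M U) :
  open U -> open W -> W `<=` U ->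
  res W (\sum_(i <- r) F i) = \sum_(i <- r) res W (F i).
Proof. by move=> oU oW WU; apply: add_map_sum => m n; exact: resD. Qed.

Lemma scal_sum (U : set X) (s : X -> k) (I : Type) (r : seq I) (F : I -> M U) :
  open U -> reg U s ->
  scal s (\sum_(i <- r) F i) = \sum_(i <- r) scal s (F i).
Proof. by move=> oU sU; apply: add_map_sum => m n; exact: scalDr. Qed.

Lemma scal0l (U : set X) (s : X -> k) (m : M U) : open U -> reg U s ->
  (forall x, U x -> s x = 0) -> scal s m = 0.
Proof.
move=> oU sU s0; apply: (@addrI _ (scal s m)); rewrite addr0 -scalDl //.
by apply: (scal_ext _ oU (reg_add oU sU sU) sU) => x Ux; rewrite !s0 ?addr0.
Qed.

Lemma scalNl (U : set X) (s : X -> k) (m : M U) : open U -> reg U s ->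
  scal (fun x => - s x) m = - scal s m.
Proof.
move=> oU sU; have sN := reg_opp oU sU.
apply: (@addrI _ (scal s m)); rewrite -scalDl // subrr; apply: scal0l => //.
  exact: reg_add.
by move=> x _; rewrite subrr.
Qed.

Lemma induces_sum (U W : set X) (I : Type) (r : seq I)
    (S : I -> sheafify M U) (F : I -> M W) :
  open W -> W `<=` U -> (forall i, induces (S i) (F i)) ->
  induces (\sum_(i <- r) S i) (\sum_(i <- r) F i).
Proof.
move=> oW WU h; elim: r => [|i r IH].
  by rewrite !big_nil; exact: induces0.
by rewrite !big_cons; exact: inducesD.
Qed.

Lemma sheaf_on_cover (I : Type) (C : I -> set X) (U : set X) :
  is_sheaf M -> (forall i, open (C i)) -> U = \bigcup_i C i ->
  (forall m n : M U, (forall i, res (C i) m = res (C i) n) -> m = n) /\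
  (forall m : forall i, M (C i),
    (forall i j, res (C i `&` C j) (m i) = res (C i `&` C j) (m j)) ->
    exists n : M U, forall i, res (C i) n = m i).
Proof. by move=> h oC ->; exact: h. Qed.

Lemma sheaf_separated (U : set X) (m n : M U) : is_sheaf M ->
  (forall x, U x -> germ_eq x m n) -> m = n.
Proof.
move=> sM h.
pose J := {W : set X | [/\ open W, W `<=` U & res W m = res W n]}.
have [||sep _] := @sheaf_on_cover J (fun j => proj1_sig j) U sM.
- by move=> j; case: (proj2_sig j).
- apply/seteqP; split=> [x Ux|x [[W [oW WU e]] _ Wx]]; last exact: (WU x Wx).
  have [W [oW Wx WU _ e]] := h x Ux.
  have hW : [/\ open W, W `<=` U & res W m = res W n] by [].
  by exists (exist _ W hW).
- by apply: sep => j; case: (proj2_sig j).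
Qed.
End EqmodSums.

Section TensorElements.
Variables (k : closedFieldType) (G : finGroupType) (X : kspace k)
  (a : gaction G X) (M N : eqmod a).

Definition tens (U : set X) (m : M U) (n : N U) : tensor_presheaf M N U :=
  gbase (@tensor_adm _ _ _ _ M N U) (m, n).

Variable U : set X.
Implicit Types (m : M U) (n : N U).

Lemma gev_tens (A : zmodType) (phi : M U * N U -> A) m n :
  tensor_adm phi -> gev phi (tens m n) = phi (m, n).
Proof. exact: gev_base. Qed.

Lemma tensDl m m' n : tens (m + m') n = tens m n + tens m' n.
Proof.
by apply: genP => A phi h; rewrite gevD // !gev_tens //; case: h.
Qed.

Lemma tensDr m n n' : tens m (n + n') = tens m n + tens m n'.
Proof.
by apply: genP => A phi h; rewrite gevD // !gev_tens //; case: h.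
Qed.

Lemma tens_scall r m n : reg U r -> tens (scal r m) n = tens m (scal r n).
Proof.
move=> rU; apply: genP => A phi h; rewrite !gev_tens //.
by case: h => _ _; exact.
Qed.

Lemma tens_suml (I : Type) (s : seq I) (F : I -> M U) n :
  tens (\sum_(i <- s) F i) n = \sum_(i <- s) tens (F i) n.
Proof. exact: (add_map_sum (fun m m' => tensDl m m' n)). Qed.

Lemma tens_res W m n : open U -> open W -> W `<=` U ->
  res W (tens m n) = tens (res W m) (res W n).
Proof.
by move=> oU oW WU; apply: gmap_base => A phi; exact: Defs.adm_res_subproof.
Qed.

Lemma tens_scal r m n : open U -> reg U r ->
  scal r (tens m n) = tens (scal r m) n.
Proof.
by move=> oU rU; apply: gmap_base => A phi; exact: Defs.adm_scal_subproof.
Qed.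

Lemma tens_lam g m n : open U -> lam g (tens m n) = tens (lam g m) (lam g n).
Proof.
by move=> oU; apply: gmap_base => A phi; exact: Defs.adm_lam_subproof.
Qed.
Lemma tens_ext (A : zmodType) (f g : tensor_presheaf M N U -> A) :
  {morph f : c d / c + d} -> {morph g : c d / c + d} ->
  (forall m n, f (tens m n) = g (tens m n)) -> f =1 g.
Proof.
move=> fD gD h c; elim/gen_ind: c => [[m n]||c e|c d ec ed]; first exact: h.
- by rewrite !add_map0.
- by rewrite !add_mapN // e.
- by rewrite fD gD ec ed.
Qed.
End TensorElements.

Section PullElements.
Variables (k : closedFieldType) (G : finGroupType) (Y X : kspace k)
  (aY : gaction G Y) (aX : gaction G X) (q : smorphism Y X)
  (hq : equivariant aY aX q) (M : eqmod aX).

Definition pull_elt (W : set Y) (U : set X) (m : M U) (b : Y -> k) :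
  pull_presheaf hq M W := gbase (@pull_adm _ _ _ _ _ q M W) (pull_mk m b).

Lemma gev_pull (W : set Y) (A : zmodType) (phi : pull_gen Y M -> A) (U : set X)
    (m : M U) b :
  pull_adm q W phi -> gev phi (pull_elt W m b) = phi (pull_mk m b).
Proof. exact: gev_base. Qed.

Variables (W : set Y) (U : set X).
Implicit Types (m : M U) (b : Y -> k).
Local Notation dom m b := (pull_dom q W (pull_mk m b)).

Lemma pull_elt_undef m b : ~ dom m b -> pull_elt W m b = 0.
Proof.
move=> h; apply: genP => A phi H; rewrite gev_pull // gev0 //.
by case: H => _; apply.
Qed.

Lemma pull_eltDl m m' b : dom m b ->
  pull_elt W (m + m') b = pull_elt W m b + pull_elt W m' b.
Proof.
move=> d; apply: genP => A phi h; rewrite gevD // !gev_pull //.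
by case: h => h _; exact: (pull_addm h).
Qed.

Lemma pull_elt_bal m b r : dom m b -> reg U r ->
  pull_elt W (scal r m) b = pull_elt W m (fun y => r (q y) * b y).
Proof.
move=> d rU; apply: genP => A phi h; rewrite !gev_pull //.
by case: h => h _; exact: (pull_bal h).
Qed.

Lemma pull_elt_resl (V : set X) m b : dom m b ->
  open V -> V `<=` U -> W `<=` q @^-1` V ->
  pull_elt W (res V m) b = pull_elt W m b.
Proof.
move=> d oV VU WV; apply: genP => A phi h; rewrite !gev_pull //.
by case: h => h _; exact: (pull_res h).
Qed.

Lemma pull_elt_ext m b b' : dom m b -> reg W b' ->
  (forall y, W y -> b y = b' y) -> pull_elt W m b = pull_elt W m b'.
Proof.
move=> d b'W bb; apply: genP => A phi h; rewrite !gev_pull //.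
by case: h => h _; exact: (pull_ext h).
Qed.

Lemma pull_elt_suml (I : Type) (s : seq I) (F : I -> M U) b :
  open U -> W `<=` q @^-1` U -> reg W b ->
  pull_elt W (\sum_(i <- s) F i) b = \sum_(i <- s) pull_elt W (F i) b.
Proof.
move=> oU WU bW.
apply: (@add_map_sum _ _ (fun m => pull_elt W m b)) => m m'.
exact: pull_eltDl.
Qed.

Hypothesis oW : open W.

Lemma pull_elt_res (W' : set Y) m b : open W' -> W' `<=` W -> dom m b ->
  res W' (pull_elt W m b) = pull_elt W' m b.
Proof.
move=> oW' W'W d; rewrite /pull_elt -[in RHS](Defs.trimT_subproof d).
by apply: gmap_base => A phi; exact: Defs.adm_res_subproof0.
Qed.

Lemma pull_elt_scal m b r : reg W r -> dom m b ->
  scal r (pull_elt W m b) = pull_elt W m (fun y => r y * b y).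
Proof.
move=> rW d; have e := Defs.trimT_subproof d; rewrite /= in e.
etransitivity; first apply: gmap_base => A phi.
  exact: Defs.adm_scal_subproof0.
by rewrite /pull_elt /= e.
Qed.

Lemma pull_elt_lam g m b : dom m b ->
  lam g (pull_elt W m b) = pull_elt (aY g @^-1` W) (lam g m) (b \o aY g).
Proof.
move=> d; have e := Defs.trimT_subproof d; rewrite /= in e.
etransitivity; first apply: gmap_base => A phi.
  exact: Defs.adm_lam_subproof0.
by rewrite /pull_elt /= e.
Qed.
End PullElements.

Section ToSheaf.
Variables (k : closedFieldType) (G : finGroupType) (X : kspace k)
  (a : gaction G X) (M : eqmod a).

Definition to_sheaf (U : set X) (m : M U) : sheafify M U :=
  glue U (fun W n => [/\ open W, W `<=` U & n = res W m]).

Lemma to_sheaf_induces (U : set X) (m : M U) : open U -> induces (to_sheaf m) m.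
Proof.
move=> oU; apply: glue_in; last by split => //; rewrite res_id.
split=> [W n [] //|x|W n W' n' x [oW WU ->] [oW' WU' ->] Wx Wx'].
  move=> /interior_subset Ux; exists U, m; split => //.
  by split => //; rewrite res_id.
apply: (germ_trans oW oU oW'); first exact: germ_res.
by apply: germ_sym; exact: germ_res.
Qed.

Lemma to_sheaf_eq (U : set X) (m : M U) (s : sheafify M U) :
  open U -> induces s m -> to_sheaf m = s.
Proof.
move=> oU h; apply: shsec_ext => // x Ux; exists U, m; split => //.
exact: to_sheaf_induces.
Qed.

Lemma to_sheaf_hom : eqmod_hom to_sheaf.
Proof.
split.
- move=> U oU m n; apply: to_sheaf_eq => //.
  by apply: inducesD; exact: to_sheaf_induces.
- move=> U r m oU rU; apply: to_sheaf_eq => //.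
  by apply: induces_scal => //; exact: to_sheaf_induces.
- move=> U V m oU oV VU; apply: to_sheaf_eq => //.
  apply: induces_res => //; apply: induces_restrict => //.
  exact: to_sheaf_induces.
- move=> U g m oU; apply: to_sheaf_eq; first exact: mcont.
  by apply: induces_lam => //; exact: to_sheaf_induces.
Qed.
End ToSheaf.

Section Unit.
Variables (k : closedFieldType) (G : finGroupType) (Y X : kspace k)
  (aY : gaction G Y) (aX : gaction G X) (q : smorphism Y X)
  (hq : equivariant aY aX q) (M : eqmod aX).

(* m |-> q^*m, before and after passing to the associated sheaf *)
Definition unit_pre (U : set X) (m : M U) : pull_presheaf hq M (q @^-1` U) :=
  pull_elt hq (q @^-1` U) m (fun=> 1).

Definition unit_map (U : set X) (m : M U) :
    sheafify (pull_presheaf hq M) (q @^-1` U) :=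
  to_sheaf (unit_pre m).

Lemma dom_one (W : set Y) (U : set X) (m : M U) :
  open U -> open W -> W `<=` q @^-1` U -> pull_dom q W (pull_mk m (fun=> 1)).
Proof. by move=> oU oW WU; split => //; exact: reg_cst. Qed.

Lemma unit_pre_hom :
  @eqmod_hom _ _ _ _ M (direct_image hq (pull_presheaf hq M)) unit_pre.
Proof.
have oq (U : set X) : open U -> open (q @^-1` U) := @mcont _ _ _ q U.
split.
- by move=> U oU m n; apply: pull_eltDl; apply: dom_one => //; exact: oq.
- move=> U r m oU rU; have d := dom_one m oU (oq _ oU) (@subset_refl _ _).
  have rqU := mreg q oU rU.
  rewrite /unit_pre pull_elt_bal //; symmetry; apply: pull_elt_scal => //.
  exact: oq.
- move=> U V m oU oV VU.
  have VU' : q @^-1` V `<=` q @^-1` U by move=> y /VU.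
  rewrite /unit_pre pull_elt_resl //; last by apply: dom_one => //; exact: oq.
  symmetry; apply: pull_elt_res => //; try exact: oq.
  by apply: dom_one => //; exact: oq.
- move=> U g m oU; have d := dom_one m oU (oq _ oU) (@subset_refl _ _).
  have oV := mcont (aX g) oU; have oW := mcont (aY g) (oq _ oU).
  change (unit_pre (lam g m) =
    res (q @^-1` (aX g @^-1` U)) (lam g (unit_pre m))).
  rewrite /unit_pre pull_elt_lam ?pull_elt_res //; try exact: oq.
  + by rewrite (equi_preim hq).
  + by apply: dom_one => //; rewrite (equi_preim hq).
Qed.

Lemma unit_map_hom :
  @eqmod_hom _ _ _ _ M
    (direct_image hq (sheafify (pull_presheaf hq M))) unit_map.
Proof.
have oq (U : set X) : open U -> open (q @^-1` U) := @mcont _ _ _ q U.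
have ts := to_sheaf_hom (pull_presheaf hq M).
split.
- move=> U oU m n; rewrite /unit_map (homD unit_pre_hom) //.
  by rewrite (homD ts) //; exact: oq.
- move=> U r m oU rU; rewrite /unit_map (hom_scal unit_pre_hom) //.
  by rewrite (hom_scal ts) //; [exact: oq|exact: mreg].
- move=> U V m oU oV VU; rewrite /unit_map (hom_res unit_pre_hom) //.
  by rewrite (hom_res ts) //; [exact: oq|exact: oq|move=> y /VU].
- move=> U g m oU; rewrite /unit_map (hom_lam unit_pre_hom) //=.
  have oW := mcont (aY g) (oq _ oU).
  rewrite (hom_res ts) // ?(hom_lam ts) //; try exact: oq.
  + by apply: oq; exact: mcont.
  + by rewrite (equi_preim hq).
Qed.

Variable F : eqmod aY.

Definition proj_map (U : set X) :
    tensor_presheaf M (direct_image hq F) U ->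
    tensor_presheaf (sheafify (pull_presheaf hq M)) F (q @^-1` U) :=
  gmap _ (fun t : M U * F (q @^-1` U) => (unit_map t.1, t.2)).

Lemma proj_map_adm (U : set X) (A : zmodType)
    (phi : sheafify (pull_presheaf hq M) (q @^-1` U) * F (q @^-1` U) -> A) :
  open U -> tensor_adm phi ->
  @tensor_adm _ _ _ _ M (direct_image hq F) U A
    (phi \o (fun t : M U * F (q @^-1` U) => (unit_map t.1, t.2))).
Proof.
move=> oU [h1 h2 h3]; split=> /=.
- by move=> m m' n; rewrite (homD unit_map_hom).
- by move=> m n n'; exact: h2.
- by move=> r m n rU; rewrite (hom_scal unit_map_hom) // h3 //; exact: mreg.
Qed.

Lemma proj_map_tens (U : set X) (m : M U) (n : F (q @^-1` U)) : open U ->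
  proj_map (@tens _ _ _ _ M (direct_image hq F) U m n) = tens (unit_map m) n.
Proof. by move=> oU; apply: gmap_base => A phi; exact: proj_map_adm. Qed.

Lemma proj_mapD (U : set X) : open U -> {morph @proj_map U : m n / m + n}.
Proof. by move=> oU m n; apply: gmapD => A phi; exact: proj_map_adm. Qed.

Lemma proj_map_hom : @eqmod_hom _ _ _ _
  (tensor_presheaf M (direct_image hq F))
  (direct_image hq (tensor_presheaf (sheafify (pull_presheaf hq M)) F))
  proj_map.
Proof.
have oq (U : set X) : open U -> open (q @^-1` U) := @mcont _ _ _ q U.
split.
- exact: proj_mapD.
- move=> U r m oU rU; have rqU := mreg q oU rU; move: m.
  apply: tens_ext => [c d|c d|m n].
  + by rewrite scalDr // proj_mapD.
  + by rewrite proj_mapD // scalDr.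
  + rewrite tens_scal // !proj_map_tens // (hom_scal unit_map_hom) //.
    by rewrite [RHS]tens_scal //; exact: oq.
- move=> U V m oU oV VU; have VU' : q @^-1` V `<=` q @^-1` U by move=> y /VU.
  move: m; apply: tens_ext => [c d|c d|m n].
  + by rewrite resD // proj_mapD.
  + by rewrite proj_mapD // resD.
  + rewrite tens_res // !proj_map_tens // (hom_res unit_map_hom) //.
    by rewrite [RHS]tens_res //; exact: oq.
- move=> U g m oU; have oV := mcont (aX g) oU.
  have oW := mcont (aY g) (oq _ oU).
  move: m; apply: tens_ext => [c d|c d|m n].
  + by rewrite lamD // proj_mapD.
  + by rewrite proj_mapD // lamD.
  + rewrite tens_lam // !proj_map_tens // (hom_lam unit_map_hom) //.
    change (tens (res (q @^-1` (aX g @^-1` U)) (lam g (unit_map m)))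
        (res (q @^-1` (aX g @^-1` U)) (lam g (n : F (q @^-1` U))))
      = res (q @^-1` (aX g @^-1` U)) (lam g (tens (unit_map m) n))).
    rewrite tens_lam ?tens_res //; try exact: oq.
    by rewrite (equi_preim hq).
Qed.
End Unit.

Section Frame.
Variables (k : closedFieldType) (G : finGroupType) (Y X : kspace k)
  (aY : gaction G Y) (aX : gaction G X) (q : smorphism Y X)
  (hq : equivariant aY aX q) (M : eqmod aX).
Variables (U0 : set X) (oU0 : open U0) (n : nat) (e : 'I_n -> M U0).
Hypothesis e_basis : forall V : set X, open V -> V `<=` U0 ->
  (forall m : M V, exists r : 'I_n -> X -> k,
    (forall i, reg V (r i)) /\ m = \sum_i scal (r i) (res V (e i))) /\
  (forall r : 'I_n -> X -> k, (forall i, reg V (r i)) ->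
    \sum_i scal (r i) (res V (e i)) = 0 ->
    forall i x, V x -> r i x = 0).

Let oq (U : set X) : open U -> open (q @^-1` U) := @mcont _ _ _ q U.

Definition coords (U : set X) (m : M U) : 'I_n -> X -> k :=
  if pselect (open U) is left oU then
    projT1 (cid (proj1 (e_basis (openI oU oU0) (@subIsetr _ _ _))
                       (res (U `&` U0) m)))
  else fun _ _ => 0.

Lemma coordsP (U : set X) (m : M U) : open U ->
  (forall i, reg (U `&` U0) (coords m i)) /\
  res (U `&` U0) m = \sum_i scal (coords m i) (res _ (e i)).
Proof. by move=> oU; rewrite /coords; case: pselect => // o; case: cid. Qed.

Lemma coords_uniq (U V : set X) (m : M U) (r : 'I_n -> X -> k) : open U ->
  open V -> V `<=` U -> V `<=` U0 -> (forall i, reg V (r i)) ->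
  res V m = \sum_i scal (r i) (res V (e i)) ->
  forall i x, V x -> coords m i x = r i x.
Proof.
move=> oU oV VU VU0 rV em i x Vx; have [cr ce] := coordsP m oU.
have oI := openI oU oU0; have VI : V `<=` U `&` U0 by move=> y; split; auto.
have cV j : reg V (coords m j) by exact: reg_sub (cr j).
have rN j := reg_opp oV (rV j).
apply/eqP; rewrite -subr_eq0; apply/eqP.
apply: (proj2 (e_basis oV VU0) (fun j y => coords m j y - r j y)) => //.
  by move=> j; exact: reg_add.
under eq_bigr => j _ do rewrite scalDl // scalNl //.
rewrite big_split sumrN /= -em -(res_comp m oU oI oV (@subIsetl _ _ _) VI) ce.
rewrite res_sum //; apply/eqP; rewrite subr_eq0; apply/eqP.
apply: eq_bigr => j _.
by rewrite res_scal // res_comp.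
Qed.

Lemma coordsD (U : set X) (m m' : M U) i x : open U -> U x -> U0 x ->
  coords (m + m') i x = coords m i x + coords m' i x.
Proof.
move=> oU Ux U0x; have oI := openI oU oU0.
have [r1 e1] := coordsP m oU; have [r2 e2] := coordsP m' oU.
have iU : U `&` U0 `<=` U by exact: subIsetl.
have iU0 : U `&` U0 `<=` U0 by exact: subIsetr.
pose r i x := coords m i x + coords m' i x.
apply: (@coords_uniq U (U `&` U0) (m + m') r) => // [j|].
  exact: reg_add.
rewrite resD // e1 e2 -big_split; apply: eq_bigr => j _ /=.
by rewrite /r scalDl.
Qed.

Lemma coords_scal (U : set X) (m : M U) s i x : open U -> reg U s ->
  U x -> U0 x -> coords (scal s m) i x = s x * coords m i x.
Proof.
move=> oU sU Ux U0x; have oI := openI oU oU0.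
have [r1 e1] := coordsP m oU.
have iU : U `&` U0 `<=` U by exact: subIsetl.
have iU0 : U `&` U0 `<=` U0 by exact: subIsetr.
have sI := reg_sub oU oI iU sU.
apply: (@coords_uniq U (U `&` U0) (scal s m) (fun i x => s x * coords m i x))
  => // [j|].
  exact: reg_mul.
rewrite res_scal // e1 scal_sum //; apply: eq_bigr => j _ /=.
by rewrite scalM.
Qed.

Lemma coords_res (U V : set X) (m : M U) i x : open U -> open V -> V `<=` U ->
  V x -> U0 x -> coords (res V m) i x = coords m i x.
Proof.
move=> oU oV VU Vx U0x; have oI := openI oV oU0.
have [r1 e1] := coordsP (res V m) oV; symmetry.
have iV : V `&` U0 `<=` V by exact: subIsetl.
apply: (@coords_uniq U (V `&` U0) m (coords (res V m))) => //.
  exact: subset_trans iV VU.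
by rewrite -e1 res_comp.
Qed.

Section PullCoords.
Variables (W : set Y) (oW : open W) (WU0 : W `<=` q @^-1` U0).

(* b (x) m |-> the value at y of the i-th coordinate of b q^*m; a pointwise
   definition avoids gluing regular functions *)
Definition ev_coord (i : 'I_n) (y : Y) (t : pull_gen Y M) : k :=
  if `[< pull_dom q W t >] then coords (projT2 t).1 i (q y) * (projT2 t).2 y
  else 0.

Lemma ev_coordE i y (U : set X) (m : M U) b : pull_dom q W (pull_mk m b) ->
  ev_coord i y (pull_mk m b) = coords m i (q y) * b y.
Proof. by move=> d; rewrite /ev_coord; case: asboolP. Qed.

Lemma ev_coord_adm i y : W y -> pull_adm q W (ev_coord i y).
Proof.
move=> Wy; split; last by move=> t ht; rewrite /ev_coord; case: asboolP.
have U0y := WU0 Wy.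
split.
- move=> U m m' b d; rewrite !ev_coordE //; case: d => /= oU WU bW.
  by rewrite coordsD // ?mulrDl //; exact: WU.
- move=> U m b b' d d'; rewrite !ev_coordE //; first by rewrite mulrDr.
  by case: d d' => /= ? ? ? [? ? ?]; split => //; exact: reg_add.
- move=> U m b r d rU; have rqU oU := mreg q oU rU.
  rewrite !ev_coordE //; case: d => /= oU WU bW.
    by rewrite coords_scal // -?mulrA 1?mulrCA //; exact: WU.
  split => //=; apply: reg_mul => //.
  by apply: (reg_sub _ _ _ (rqU oU)) => //; exact: oq.
- move=> U V m b d oV VU WV; rewrite !ev_coordE //; case: d => /= oU WU bW //.
  by rewrite coords_res //; exact: WV.
- move=> U m b b' d b'W bb; rewrite !ev_coordE ?bb //.
  by case: d.
Qed.

Definition pcoord (p : pull_presheaf hq M W) (i : 'I_n) (y : Y) : k :=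
  gev (ev_coord i y) p.

Lemma pcoordD p p' i y : W y ->
  pcoord (p + p') i y = pcoord p i y + pcoord p' i y.
Proof. by move=> Wy; apply: gevD; exact: ev_coord_adm. Qed.

Lemma pcoord_elt (U : set X) (m : M U) b i y : W y ->
  pull_dom q W (pull_mk m b) ->
  pcoord (pull_elt hq W m b) i y = coords m i (q y) * b y.
Proof.
by move=> Wy d; rewrite /pcoord gev_pull ?ev_coordE //; exact: ev_coord_adm.
Qed.

Lemma pcoord0 i y : W y -> pcoord 0 i y = 0.
Proof. by move=> Wy; apply: gev0; exact: ev_coord_adm. Qed.

Lemma pcoordN p i y : W y -> pcoord (- p) i y = - pcoord p i y.
Proof. by move=> Wy; apply: gevN; exact: ev_coord_adm. Qed.

Lemma pull_ind (P : pull_presheaf hq M W -> Prop) :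
  (forall (U : set X) (m : M U) b, pull_dom q W (pull_mk m b) ->
    P (pull_elt hq W m b)) -> P 0 -> (forall p, P p -> P (- p)) ->
  (forall p p', P p -> P p' -> P (p + p')) -> forall p, P p.
Proof.
move=> Pe P0 PN PD; apply: gen_ind => // -[U [m b]].
have [d|d] := pselect (pull_dom q W (pull_mk m b)); first exact: Pe.
by have := pull_elt_undef hq d; rewrite /pull_elt => ->.
Qed.

Lemma pcoord_reg p i : reg W (pcoord p i).
Proof.
elim/pull_ind: p => [U m b d||p IH|p p' IH IH'].
- have [/= oU WU bW] := d; have [cr _] := coordsP m oU.
  apply: (@reg_eq _ _ _ (fun y => coords m i (q y) * b y)) => //.
    by move=> y Wy; rewrite pcoord_elt.
  apply: reg_mul => //.
  have oI := openI oU oU0.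
  apply: (reg_sub (oq oI) oW _ (mreg q oI (cr i))).
  by move=> y Wy; split; [exact: WU|exact: WU0].
- by apply: (reg_eq oW _ (reg_cst 0 oW)) => y Wy; rewrite pcoord0.
- by apply: (reg_eq oW _ (reg_opp oW IH)) => y Wy; rewrite pcoordN.
- by apply: (reg_eq oW _ (reg_add oW IH IH')) => y Wy; rewrite pcoordD.
Qed.

Lemma pcoord_scal p r i y : reg W r -> W y ->
  pcoord (scal r p) i y = r y * pcoord p i y.
Proof.
move=> rW Wy; elim/pull_ind: p => [U m b d||p IH|p p' IH IH'].
- rewrite pull_elt_scal // !pcoord_elt //; first by rewrite mulrCA.
  by case: d => ? ? ?; split => //; exact: reg_mul.
- by rewrite scal0 // pcoord0 // mulr0.
- rewrite (add_mapN (f := scal r)); last by move=> ? ?; exact: scalDr.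
  by rewrite !pcoordN // IH mulrN.
- by rewrite scalDr // !pcoordD // IH IH' mulrDr.
Qed.

Lemma pull_decomp p :
  p = \sum_i scal (pcoord p i) (pull_elt hq W (e i) (fun=> 1)).
Proof.
have de i : pull_dom q W (pull_mk (e i) (fun=> 1)) by exact: dom_one.
elim/pull_ind: p => [U m b d||p IH|p p' IH IH'].
- have [/= oU WU bW] := d; have [cr ce] := coordsP m oU.
  have oI := openI oU oU0.
  have WI : W `<=` q @^-1` (U `&` U0).
    by move=> y Wy; split; [exact: WU|exact: WU0].
  rewrite -[LHS](pull_elt_resl hq d oI (@subIsetl _ _ _) WI) ce.
  rewrite pull_elt_suml //; apply: eq_bigr => i _.
  have cW : reg W (fun y => coords m i (q y)).
    exact: (reg_sub (oq oI) oW WI (mreg q oI (cr i))).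
  have cbW := reg_mul oW cW bW.
  rewrite pull_elt_bal //.
  rewrite (pull_elt_resl hq _ oI (@subIsetr _ _ _) WI) //.
  have pr := pcoord_reg (pull_elt hq W m b) i.
  transitivity (pull_elt hq W (e i)
      (fun y => pcoord (pull_elt hq W m b) i y * 1)).
    apply: pull_elt_ext => //; first by apply: reg_mul => //; exact: reg_cst.
    by move=> y Wy; rewrite pcoord_elt // mulr1.
  by symmetry; apply: pull_elt_scal.
- rewrite big1 // => i _; apply: scal0l => //; first exact: pcoord_reg.
  by move=> y Wy; rewrite pcoord0.
- rewrite {1}IH -sumrN; apply: eq_bigr => i _.
  rewrite -scalNl //; last exact: pcoord_reg.
  apply: scal_ext => //; try exact: pcoord_reg.
    by apply: reg_opp => //; exact: pcoord_reg.
  by move=> y Wy; rewrite pcoordN.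
- rewrite {1}IH {1}IH' -big_split; apply: eq_bigr => i _.
  have [h h'] := (pcoord_reg p i, pcoord_reg p' i).
  rewrite -[LHS](scalDl _ oW h h'); apply: scal_ext => //.
  + exact: reg_add.
  + exact: pcoord_reg.
  + by move=> y Wy; rewrite pcoordD.
Qed.
End PullCoords.

Lemma pcoord_res (W W' : set Y) (p : pull_presheaf hq M W) i y :
  open W -> open W' -> W' `<=` W -> W `<=` q @^-1` U0 -> W' y ->
  pcoord (res W' p) i y = pcoord p i y.
Proof.
move=> oW oW' W'W WU0 W'y; have Wy := W'W _ W'y.
have W'U0 := subset_trans W'W WU0.
elim/pull_ind: p => [U m b d||p IH|p p' IH IH'].
- rewrite (pull_elt_res hq oW) // !pcoord_elt //.
  case: d => oU WU bW.
  by split => //; [exact: subset_trans WU|exact: reg_sub bW].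
- by rewrite res0 // !pcoord0.
- rewrite (add_mapN (f := res W')); last by move=> ? ?; exact: resD.
  by rewrite !pcoordN // IH.
- by rewrite resD // !pcoordD // IH IH'.
Qed.

Section SheafCoords.
Variables (W : set Y) (oW : open W) (WU0 : W `<=` q @^-1` U0).
Implicit Types (s : sheafify (pull_presheaf hq M) W).
Local Notation pinduces s p :=
  (@induces _ _ _ _ (pull_presheaf hq M) W s _ p).

Definition scoord s (i : 'I_n) (y : Y) : k :=
  if pselect (exists t : {W' : set Y & pull_presheaf hq M W'},
      projT1 t y /\ pinduces s (projT2 t))
    is left h then pcoord (projT2 (projT1 (cid h))) i y else 0.

Lemma scoordE s (W' : set Y) (p : pull_presheaf hq M W') i y :
  pinduces s p -> W' y -> scoord s i y = pcoord p i y.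
Proof.
move=> h W'y; rewrite /scoord; case: pselect => [h'|[]]; last first.
  by exists (existT _ W' p).
case: cid => -[V p'] /= [Vy hp'].
have [A [oA Ay AV AW' e']] := induces_germ hp' h Vy W'y.
have oV := induces_open hp'; have oW' := induces_open h.
have VU0 := subset_trans (induces_subset hp') WU0.
have W'U0 := subset_trans (induces_subset h) WU0.
by rewrite -(pcoord_res _ _ oV oA AV VU0 Ay) e' pcoord_res.
Qed.

Lemma scoord_common s t y : W y ->
  exists (V : set Y) (p r : pull_presheaf hq M V),
  [/\ open V, V y, V `<=` q @^-1` U0, pinduces s p & pinduces t r].
Proof.
move=> Wy; have [V [p [r [Vy hp hr]]]] := induces_common s t oW Wy.
exists V, p, r; split => //; first exact: induces_open hp.
exact: subset_trans (induces_subset hp) WU0.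
Qed.

Lemma scoordD s t i y : W y -> scoord (s + t) i y = scoord s i y + scoord t i y.
Proof.
move=> Wy; have [V [p [r [oV Vy VU0 hp hr]]]] := scoord_common s t Wy.
rewrite (scoordE _ hp) // (scoordE _ hr) //.
by rewrite (scoordE _ (inducesD hp hr)) // pcoordD.
Qed.

Lemma scoord_scal s r i y : reg W r -> W y ->
  scoord (scal r s) i y = r y * scoord s i y.
Proof.
move=> rW Wy; have [V [p [_ [oV Vy VU0 hp _]]]] := scoord_common s s Wy.
rewrite (scoordE _ hp) // (scoordE _ (induces_scal oW rW hp)) //.
by rewrite pcoord_scal //; exact: reg_sub (induces_subset hp) rW.
Qed.

Lemma scoord_reg s i : reg W (scoord s i).
Proof.
apply/reg_local => // y Wy.
have [V [p [_ [oV Vy VU0 hp _]]]] := scoord_common s s Wy.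
exists V, (pcoord p i); split => //; first exact: pcoord_reg.
by move=> z Vz _; exact: scoordE.
Qed.

Lemma frame_decomp s :
  s = \sum_i scal (scoord s i) (res W (unit_map hq (e i))).
Proof.
apply: shsec_ext => // y Wy.
have [V [p [_ [oV Vy VU0 hp _]]]] := scoord_common s s Wy.
have VW := induces_subset hp; exists V, p; split => //.
rewrite (pull_decomp oV VU0 p); apply: induces_sum => // i.
have sV : reg V (scoord s i) := reg_sub oW oV VW (scoord_reg s i).
rewrite (_ : scal (pcoord p i) _ =
    scal (scoord s i) (res V (unit_pre hq (e i)))).
  apply: induces_scal => //; first exact: scoord_reg.
  apply: induces_res => //.
  apply: induces_restrict => //.
  by apply: to_sheaf_induces; exact: oq.
have d := dom_one (e i) oU0 (oq oU0) (@subset_refl _ _).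
rewrite /unit_pre (pull_elt_res hq (oq oU0) oV VU0 d).
apply: scal_ext => //; first exact: pcoord_reg.
by move=> z Vz; rewrite (scoordE _ hp).
Qed.
End SheafCoords.

Lemma scoord_unit (U : set X) (m : M U) i y : open U -> U `<=` U0 -> U (q y) ->
  scoord (unit_map hq m) i y = coords m i (q y).
Proof.
move=> oU UU0 Uy; have UU0' : q @^-1` U `<=` q @^-1` U0 by move=> z /UU0.
rewrite (scoordE UU0' _ (to_sheaf_induces _ (oq oU))) // pcoord_elt //.
- by rewrite mulr1.
- exact: oq.
- by apply: dom_one => //; exact: oq.
Qed.

Lemma scoord_res (W W' : set Y) (s : sheafify (pull_presheaf hq M) W) i y :
  open W -> open W' -> W' `<=` W -> W `<=` q @^-1` U0 -> W' y ->
  scoord (res W' s) i y = scoord s i y.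
Proof.
move=> oW oW' W'W WU0 W'y; have Wy := W'W _ W'y.
have [V [p [Vy hp]]] := induces_cover s oW Wy.
have oI := openI (induces_open hp) oW'.
have iV : V `&` W' `<=` V by exact: subIsetl.
have iW' : V `&` W' `<=` W' by exact: subIsetr.
have h' := induces_restrict hp oI iV.
have h'' := induces_res W'W iW' h'.
by rewrite (scoordE WU0 _ h') // (scoordE (subset_trans W'W WU0) _ h'').
Qed.

Section TensorCoords.
Variables (F : eqmod aY).
Local Notation T' := (tensor_presheaf (sheafify (pull_presheaf hq M)) F).

Definition tcoord (W : set Y) (c : T' W) (i : 'I_n) : F W :=
  gev (fun t : sheafify (pull_presheaf hq M) W * F W =>
    scal (scoord t.1 i) t.2) c.

Arguments tcoord : clear implicits.

Section OneOpen.
Variables (W : set Y) (oW : open W) (WU0 : W `<=` q @^-1` U0).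

Lemma tcoord_adm i : tensor_adm
  (fun t : sheafify (pull_presheaf hq M) W * F W => scal (scoord t.1 i) t.2).
Proof.
have sr s := scoord_reg oW WU0 s i.
split=> /= [s s' f|s f f'|r s f rW].
- rewrite -scalDl //; apply: scal_ext => //; first exact: reg_add.
  by move=> y Wy; rewrite scoordD.
- exact: scalDr.
- rewrite -scalM //; apply: scal_ext => //; first exact: reg_mul.
  by move=> y Wy; rewrite scoord_scal // mulrC.
Qed.

Lemma tcoordD c d i : tcoord W (c + d) i = tcoord W c i + tcoord W d i.
Proof. by apply: gevD; exact: tcoord_adm. Qed.

Lemma tcoord_tens (s : sheafify (pull_presheaf hq M) W) (f : F W) i :
  tcoord W (tens s f) i = scal (scoord s i) f.
Proof. by rewrite /tcoord gev_tens //; exact: tcoord_adm. Qed.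

Lemma tcoord_decomp (c : T' W) :
  c = \sum_i tens (res W (unit_map hq (e i))) (tcoord W c i).
Proof.
move: c; apply: (@tens_ext _ _ _ _ _ _ _ _ id
  (fun c => \sum_i tens (res W (unit_map hq (e i))) (tcoord W c i))) => //.
  move=> c d; rewrite -big_split; apply: eq_bigr => i _ /=.
  by rewrite tcoordD tensDr.
move=> s f /=; rewrite {1}(frame_decomp oW WU0 s) tens_suml.
apply: eq_bigr => i _; rewrite tens_scall ?tcoord_tens //.
exact: scoord_reg.
Qed.
End OneOpen.

Lemma tcoord_res (W W' : set Y) (c : T' W) i :
  open W -> open W' -> W' `<=` W -> W `<=` q @^-1` U0 ->
  tcoord W' (res W' c) i = res W' (tcoord W c i).
Proof.
move=> oW oW' W'W WU0; have W'U0 := subset_trans W'W WU0; move: c.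
apply: (@tens_ext _ _ _ _ _ _ _ _ (fun c => tcoord W' (res W' c) i)
  (fun c => res W' (tcoord W c i))).
- by move=> c d; rewrite resD // tcoordD.
- by move=> c d; rewrite tcoordD // resD.
move=> s f; rewrite tens_res // !tcoord_tens //.
rewrite res_scal //; last exact: scoord_reg.
apply: scal_ext => //; first exact: scoord_reg.
  exact: reg_sub (scoord_reg oW WU0 s i).
by move=> y W'y; rewrite scoord_res.
Qed.

Let T := tensor_presheaf M (direct_image hq F).

Lemma tens_decomp (U : set X) (c : T U) : open U -> U `<=` U0 ->
  c = \sum_i @tens _ _ _ _ M (direct_image hq F) U (res U (e i))
               (tcoord (q @^-1` U) (proj_map c) i).
Proof.
move=> oU UU0; have UU0' : q @^-1` U `<=` q @^-1` U0 by move=> z /UU0.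
move: c; apply: (@tens_ext _ _ _ _ _ _ _ _ id (fun c : T U =>
  \sum_i @tens _ _ _ _ M (direct_image hq F) U (res U (e i))
     (tcoord (q @^-1` U) (proj_map c) i))) => //.
  move=> c d; rewrite -big_split; apply: eq_bigr => i _ /=.
  rewrite (proj_mapD oU c d).
  rewrite (tcoordD (oq oU) UU0').
  exact: (@tensDr _ _ _ _ M (direct_image hq F) U).
move=> m f; have [cr ce] := coordsP m oU.
have eI : U `&` U0 = U by apply/setIidl.
rewrite eI res_id // in cr ce.
rewrite {1}ce /= tens_suml; apply: eq_bigr => i _.
rewrite tens_scall // proj_map_tens // tcoord_tens //; last exact: oq.
apply: congr1; apply: (@scal_ext _ _ _ _ F).
- exact: oq.
- exact: mreg.
- by apply: scoord_reg => //; exact: oq.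
- by move=> y Uy /=; rewrite scoord_unit.
Qed.
End TensorCoords.

Section LocalBijectivity.
Variables (F : eqmod aY) (F_sheaf : is_sheaf F).
Variables (U : set X) (oU : open U) (UU0 : U `<=` U0).

Let qU0 : q @^-1` U `<=` q @^-1` U0. Proof. by move=> y /UU0. Qed.

Lemma proj_map_inj (c d : tensor_presheaf M (direct_image hq F) U) :
  (forall y, U (q y) -> germ_eq y (proj_map c) (proj_map d)) -> c = d.
Proof.
move=> h; rewrite (tens_decomp c oU UU0) (tens_decomp d oU UU0).
apply: eq_bigr => i _; apply: congr1; apply: sheaf_separated => // y Uy.
have [A [oA Ay AU _ eA]] := h y Uy; exists A; split => //.
by rewrite -!tcoord_res ?eA //; exact: oq.
Qed.

Lemma proj_map_surj (O : set Y)
    (s : sheafify (tensor_presheaf (sheafify (pull_presheaf hq M)) F) O) :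
  open O -> q @^-1` U `<=` O ->
  exists c : tensor_presheaf M (direct_image hq F) U, induces s (proj_map c).
Proof.
move=> oO UO.
pose T' := tensor_presheaf (sheafify (pull_presheaf hq M)) F.
pose J := {t : {A : set Y & T' A} |
  @induces _ _ _ _ T' O s _ (projT2 t) /\ projT1 t `<=` q @^-1` U}.
pose C (j : J) : set Y := projT1 (proj1_sig j).
pose m (j : J) : T' (C j) := projT2 (proj1_sig j).
have mP j : @induces _ _ _ _ T' O s _ (m j) by case: (proj2_sig j).
have CU j : C j `<=` q @^-1` U by case: (proj2_sig j).
have oC j : open (C j) := induces_open (mP j).
have CU0 j : C j `<=` q @^-1` U0 := subset_trans (CU j) qU0.
have cov y : U (q y) -> exists j, C j y.
  move=> Uy; have [A [r [Ay hr]]] := induces_cover s oO (UO _ Uy).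
  have oI := openI (induces_open hr) (oq oU).
  have hr' := induces_restrict hr oI (@subIsetl _ _ _).
  by exists (exist _ (existT _ _ _) (conj hr' (@subIsetr _ _ _))).
have eC : q @^-1` U = \bigcup_j C j.
  by apply/seteqP; split=> [y /cov [j Cy]|y [j _ /CU]] //; exists j.
have fP (i : 'I_n) : exists f : F (q @^-1` U),
      forall j, res (C j) f = @tcoord F (C j) (m j) i.
  have [_ gl] := sheaf_on_cover F_sheaf oC eC.
  apply: (gl (fun j => @tcoord F (C j) (m j) i)) => j l.
  apply: sheaf_separated => // y [Cj Cl].
  have [A [oA Ay Aj Al eA]] := induces_germ (mP j) (mP l) Cj Cl.
  have AI : A `<=` C j `&` C l by move=> z Az; split; [exact: Aj|exact: Al].
  have oI := openI (oC j) (oC l).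
  exists A; split => //.
  rewrite !res_comp //; try exact: subIsetl; try exact: subIsetr.
  by rewrite -!tcoord_res ?eA.
pose f i : F (q @^-1` U) := projT1 (cid (fP i)).
have fE i j : res (C j) (f i) = @tcoord F (C j) (m j) i.
  by rewrite /f; case: cid.
pose c : tensor_presheaf M (direct_image hq F) U :=
  \sum_i @tens _ _ _ _ M (direct_image hq F) U (res U (e i)) (f i).
have cE : proj_map c =
    \sum_i tens (res (q @^-1` U) (unit_map hq (e i))) (f i).
  rewrite (add_map_sum (@proj_mapD _ _ _ _ _ _ _ hq M F U oU)).
  apply: eq_bigr => i _; rewrite proj_map_tens //.
  by rewrite (hom_res (unit_map_hom hq M)).
exists c; apply: induces_saturated => //; first exact: oq.
move=> y /cov [j Cy]; exists (C j), (m j); split => //.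
exists (C j); split => //; have oqU := oq oU; have oqU0 := oq oU0.
rewrite cE res_sum // res_id // (tcoord_decomp (oC j) (CU0 j) (m j)).
by apply: eq_bigr => i _; rewrite tens_res // res_comp // fE.
Qed.
End LocalBijectivity.
End Frame.

Theorem projection_formula (k : closedFieldType) (G : finGroupType)
    (Y X : kspace k) (aY : gaction G Y) (aX : gaction G X) (q : smorphism Y X)
    (hq : equivariant aY aX q) (V : eqmod aX) (F : eqmod aY) :
  locally_free V -> is_sheaf F ->
  eqmod_iso (direct_image hq (tensor (inverse_image hq V) F))
    (tensor V (direct_image hq F)).
Proof.
move=> Vfree Fsheaf.
apply: (@direct_image_sheafify _ _ _ _ _ _ _ hq _ _
  (@proj_map _ _ _ _ _ _ _ hq V F)); first exact: proj_map_hom.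
- move=> x; have [U0 [oU0 U0x [n [e eb]]]] := Vfree x.
  exists U0; split => // W oW WU0 c d.
  exact: (proj_map_inj oU0 eb).
- move=> U s x oU Ux; have [U0 [oU0 U0x [n [e eb]]]] := Vfree x.
  have s_qU : q @^-1` (U `&` U0) `<=` q @^-1` U by move=> y [].
  have [c hc] := proj_map_surj oU0 eb Fsheaf (openI oU oU0) (@subIsetr _ _ _)
    s (mcont q oU) s_qU.
  by exists (U `&` U0), c; split => //; exact: openI.
Qed.

(* Vector bundles on (X2,P2), resp. (X1,P1), are G-bundles on Y2, resp. on the
   normalization Y1 of the fibre product of X1 and Y2 over X2, on which G acts
   through Y2. *)
Theorem theorem3p14 (k : closedFieldType) (X1 X2 : formal_orbifold k)
    (f : smorphism X1 X2) (f_etale : etale_cover f)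
    (X2_geometric : is_geometric X2)
    (G : finGroupType) (Y2 : curve k) (a2 : gaction G Y2) (g : smorphism Y2 X2)
    (g_galois : etale_galois_cover a2 g)
    (Y1 : pcurve k) (nu : smorphism Y1 (fibre_product f g))
    (nu_normalization : is_normalization nu)
    (a1 : gaction G Y1)
    (a1_over_X1 : forall (s : G) (y : Y1),
      fibre_proj1 f g (nu (a1 s y)) = fibre_proj1 f g (nu y))
    (a1_over_Y2 : equivariant a1 a2 (mcomp (fibre_proj2 f g) nu))
    (V : bundle a2) (F : bundle a1) :
  eqmod_iso
    (direct_image a1_over_Y2 (tensor (inverse_image a1_over_Y2 V) F))
    (tensor V (direct_image a1_over_Y2 F)).
Proof.
apply: projection_formula; first exact: bundle_free.
exact: bundle_sheaf.
Qed.
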